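(* Let $(M^4,J,g_4)$ be a scalar-flat Kähler manifold of real dimension 4 with a symplectomorphic Killing field $V$. Then, away from the zeros of $V$, $$2|\mathrm{Ric}_4|^2\,dVol_4=d\left[\mathcal{L}_{\frac{\partial}{\partial z}}\left(\left(\frac{\triangle_4z}{|V|}\right)^2V_\flat\wedge dVol_2\right)-Jd\left(\frac{\triangle_4z}{|V|}\right)^2\wedge *dVol_2\right].$$
   Context: $\omega(\cdot,\cdot)=g_4(J\cdot,\cdot)$, $dVol_4=\frac12\omega\wedge\omega$; $*$ is the Hodge star. $V$ satisfies $\mathcal{L}_Vg_4=0$, $\mathcal{L}_V\omega=0$, has closed orbits, and its flow is parameterized by the unit circle with $t\in[0,2\pi)$. $V_\flat=g_4(V,\cdot)$. $J$ acts on 1-forms by $J\eta=\eta\circ J$. $z$ is a (local) Killing potential: $dz=-i_V\omega$, $\nabla z=-JV$. Where $V\ne0$, $\frac{\partial}{\partial z}=|V|^{-2}\nabla z=-|V|^{-2}JV$. $\triangle_4z$ is the Laplacian (trace of Hessian) of $z$; equivalently $\triangle_4z=*(dV_\flat\wedge\omega)$, which together with $\frac{\partial}{\partial z}$ and $dz=-i_V\omega$ makes sense even if $V$ is not Hamiltonian (the identity is asserted also in that case). $dVol_2$ is the pullback to $M^4\setminus\{V=0\}$ of the area form of the Kähler reductions $M^2_z=M^3_z/\mathbb{S}^1$, where $M^3_z$ are the level-sets of $z$; explicitly $*dVol_2=|V|^{-2}dz\wedge V_\flat$ and $dVol_2=\omega-*dVol_2$. $\mathrm{Ric}_4$ is the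 Ricci tensor of $g_4$ and $|\mathrm{Ric}_4|^2=\mathrm{Ric}_{ij}\mathrm{Ric}^{ij}$. *)

(* Defs.v *)
From HB Require Import structures.
From mathcomp Require Import all_boot all_order all_algebra all_fingroup.
From mathcomp Require Import all_classical all_reals all_analysis.

Set Implicit Arguments.
Unset Strict Implicit.
Unset Printing Implicit Defensive.

Import Order.TTheory GRing.Theory Num.Theory.
Import numFieldNormedType.Exports.

Local Open Scope classical_set_scope.
Local Open Scope ring_scope.

(* Tensor calculus in a coordinate domain of R^4. A tensor field is given by
   its components in the coordinates; all the operators below are local, and
   are only meant to be used at points of an open set on which the components
   are smooth. *)
Section TensorCalculus.
Variable R : realType.

Definition partial (i : 'I_4) (f : 'rV[R]_4 -> R) : 'rV[R]_4 -> R :=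
  fun x => 'D_(delta_mx ord0 i) f x.

(* C^infinity on U (for U open): all iterated partial derivatives are
   (Frechet-)differentiable at the points of U. *)
Definition smooth_on (U : set 'rV[R]_4) (f : 'rV[R]_4 -> R) : Prop :=
  forall (l : seq 'I_4) (x : 'rV[R]_4), U x ->
    differentiable (foldr partial f l) x.

(* Covariant k-tensor fields: [T x s] is the value at x of T on the coordinate
   vectors d_(s 0), ..., d_(s (k-1)). A k-form is represented by its full
   (alternating) array of components. *)
Definition ctensor (k : nat) : Type := 'rV[R]_4 -> ('I_k -> 'I_4) -> R.

Definition vector_field : Type := 'rV[R]_4 -> 'rV[R]_4.

(* [A x i j] is the component A^i_j of an endomorphism of the tangent bundle,
   or g_ij for a metric. *)
Definition matrix_field : Type := 'rV[R]_4 -> 'M[R]_4.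

Definition form0 (f : 'rV[R]_4 -> R) : ctensor 0 := fun x _ => f x.

Definition scale_form k (f : 'rV[R]_4 -> R) (a : ctensor k) : ctensor k :=
  fun x s => f x * a x s.

Definition opp_form k (a : ctensor k) : ctensor k := fun x s => - a x s.

Definition sub_form k (a b : ctensor k) : ctensor k :=
  fun x s => a x s - b x s.

(* Normalised so that, for 1-forms, (a /\ b)_ij = a_i b_j - a_j b_i. *)
Definition wedge k l (a : ctensor k) (b : ctensor l) : ctensor (k + l) :=
  fun x s => (k`! * l`!)%:R^-1 *
    \sum_(p : 'S_(k + l)) (-1) ^+ odd_perm p *
      (a x (fun i => s (p (lshift l i))) * b x (fun j => s (p (rshift k j)))).

(* (da)_(s_0 ... s_k) = sum_i (-1)^i d_(s_i) a_(s_0 ... omit s_i ... s_k) *)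
Definition ext_d k (a : ctensor k) : ctensor k.+1 :=
  fun x s => \sum_(i < k.+1) (-1) ^+ i *
    partial (s i) (fun y => a y (fun j => s (lift i j))) x.

Definition interior k (X : vector_field) (a : ctensor k.+1) : ctensor k :=
  fun x s => \sum_(j < 4) X x ord0 j *
    a x (fun i => if unlift ord0 i is Some i' then s i' else j).

(* (L_X T)_s = X^j d_j T_s + sum_r (d_(s_r) X^j) T_(s with s_r := j) *)
Definition lie k (X : vector_field) (T : ctensor k) : ctensor k :=
  fun x s =>
    \sum_(j < 4) X x ord0 j * partial j (fun y => T y s) x
    + \sum_(r < k) \sum_(j < 4) partial (s r) (fun y => X y ord0 j) x *
        T x (fun i => if i == r then j else s i).

Section Riemannian.
Variable g : matrix_field.

Definition metric_tensor : ctensor 2 := fun x s => g x (s ord0) (s ord_max).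

Definition ginv : matrix_field := fun x => invmx (g x).

Definition flat (X : vector_field) : ctensor 1 :=
  fun x s => \sum_(j < 4) X x ord0 j * g x j (s ord0).

Definition sharp (a : ctensor 1) : vector_field :=
  fun x => \row_(i < 4) \sum_(j < 4) ginv x i j * a x (fun _ => j).

Definition norm_vf (X : vector_field) : 'rV[R]_4 -> R :=
  fun x => Num.sqrt (\sum_(i < 4) \sum_(j < 4)
                        g x i j * X x ord0 i * X x ord0 j).

(* Gamma^k_ij *)
Definition christoffel (k i j : 'I_4) : 'rV[R]_4 -> R := fun x =>
  2^-1 * \sum_(l < 4) ginv x k l *
    (partial i (fun y => g y j l) x + partial j (fun y => g y i l) x
     - partial l (fun y => g y i j) x).

(* R^l_kij, where R(d_i, d_j) d_k = R^l_kij d_l *)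
Definition riemann (l k i j : 'I_4) : 'rV[R]_4 -> R := fun x =>
  partial i (christoffel l j k) x - partial j (christoffel l i k) x
  + \sum_(m < 4) (christoffel l i m x * christoffel m j k x
                  - christoffel l j m x * christoffel m i k x).

(* Ric(Y, Z) = tr (X |-> R(X, Y) Z) *)
Definition ricci (j k : 'I_4) : 'rV[R]_4 -> R := fun x =>
  \sum_(i < 4) riemann i k i j x.

Definition scalar_curvature : 'rV[R]_4 -> R := fun x =>
  \sum_(i < 4) \sum_(j < 4) ginv x i j * ricci i j x.

Definition ricci_norm2 : 'rV[R]_4 -> R := fun x =>
  \sum_(i < 4) \sum_(j < 4) \sum_(k < 4) \sum_(l < 4)
    ginv x i k * ginv x j l * ricci i j x * ricci k l x.

Definition hessian (z : 'rV[R]_4 -> R) (i j : 'I_4) : 'rV[R]_4 -> R := fun x =>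
  partial i (partial j z) x - \sum_(k < 4) christoffel k i j x * partial k z x.

Definition laplacian (z : 'rV[R]_4 -> R) : 'rV[R]_4 -> R := fun x =>
  \sum_(i < 4) \sum_(j < 4) ginv x i j * hessian z i j x.

(* Components with all indices raised. *)
Definition raise k (a : ctensor k) : ctensor k := fun x s =>
  \sum_(t : {ffun 'I_k -> 'I_4}) (\prod_(i < k) ginv x (s i) (t i)) * a x t.

Definition cat_index k l (s : 'I_k -> 'I_4) (t : 'I_l -> 'I_4)
    : 'I_(k + l) -> 'I_4 :=
  fun i => match fintype.split i with inl i1 => s i1 | inr i2 => t i2 end.

(* Hodge star of a k-form with respect to the volume form [vol] (the dimension
   is k + l = 4), with the convention b /\ *a = <b, a> vol. *)
Definition hodge k l (vol : ctensor (k + l)) (a : ctensor k) : ctensor l :=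
  fun x s => (k`!)%:R^-1 *
    \sum_(r : {ffun 'I_k -> 'I_4}) raise a x r * vol x (cat_index r s).

End Riemannian.

Section Hermitian.
Variables (g J : matrix_field).

(* omega(X, Y) = g(JX, Y) *)
Definition kahler_form : ctensor 2 :=
  fun x s => \sum_(k < 4) J x k (s ord0) * g x k (s ord_max).

Definition dVol4 : ctensor 4 :=
  scale_form (fun _ => 2^-1) (wedge kahler_form kahler_form).

(* J eta = eta o J *)
Definition J_form1 (a : ctensor 1) : ctensor 1 :=
  fun x s => \sum_(k < 4) a x (fun _ => k) * J x k (s ord0).

(* Components of N(X, Y) = [JX, JY] - J[JX, Y] - J[X, JY] - [X, Y] on the
   coordinate vectors X = d_i, Y = d_j. *)
Definition nijenhuis (k i j : 'I_4) : 'rV[R]_4 -> R := fun x =>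
  \sum_(l < 4) (J x l i * partial l (fun y => J y k j) x
                - J x l j * partial l (fun y => J y k i) x
                + J x k l * partial j (fun y => J y l i) x
                - J x k l * partial i (fun y => J y l j) x).

(* [zeta] stands for the 1-form dz; V need not be Hamiltonian, so it is a
   parameter, to be instantiated with - i_V omega, or with the differential of
   an actual Killing potential. *)
Section Reduction.
Variables (V : vector_field) (zeta : ctensor 1).

(* |V|^-2 nabla z *)
Definition d_dz : vector_field :=
  fun x => (norm_vf g V x ^+ 2)^-1 *: sharp g zeta x.

(* omega - |V|^-2 dz /\ V_flat *)
Definition dVol2 : ctensor 2 :=
  sub_form kahler_form
    (scale_form (fun x => (norm_vf g V x ^+ 2)^-1) (wedge zeta (flat g V))).

(* [u] stands for the Laplacian of z. *)
Definition primitive_form (u : 'rV[R]_4 -> R) : ctensor 3 :=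
  let F := fun x => (u x / norm_vf g V x) ^+ 2 in
  sub_form
    (lie d_dz (scale_form F (wedge (flat g V) dVol2)))
    (wedge (J_form1 (ext_d (form0 F))) (hodge g (k := 2) (l := 2) dVol4 dVol2)).

End Reduction.

(* - i_V omega *)
Definition killing_dz (V : vector_field) : ctensor 1 :=
  opp_form (interior V kahler_form).

(* *(dV_flat /\ omega), as a function *)
Definition killing_laplacian (V : vector_field) : 'rV[R]_4 -> R := fun x =>
  hodge g (k := 4) (l := 0) dVol4 (wedge (ext_d (flat g V)) kahler_form)
    x (fun _ => ord0).

End Hermitian.
End TensorCalculus.

(* A 4-manifold given by an atlas, indexed by [chart]. [coord a] and [param a]
   are mutually inverse homeomorphisms between the open set [dom a] and the open
   set [img a] of R^4; their values outside these sets are irrelevant. *)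
Record manifold4 (R : realType) := Manifold4 {
  points :> topologicalType;
  points_hausdorff : hausdorff_space points;
  points_second_countable : @second_countable points;
  chart : Type;
  dom : chart -> set points;
  coord : chart -> points -> 'rV[R]_4;
  param : chart -> 'rV[R]_4 -> points;
  dom_open : forall a, open (dom a);
  dom_cover : forall p, exists a, dom a p;
  coordK : forall a p, dom a p -> param a (coord a p) = p;
  img_open : forall a, open (coord a @` dom a);
  coord_continuous : forall a p, dom a p -> {for p, continuous (coord a)};
  param_continuous : forall a x, (coord a @` dom a) x ->
    {for x, continuous (param a)};
  transition_smooth : forall a b (i : 'I_4),
    smooth_on (coord a @` (dom a `&` dom b))
      (fun x => coord b (param a x) ord0 i)
}.

Arguments chart {R} m.
Arguments dom {R m} a _.
Arguments coord {R m} a _.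
Arguments param {R m} a _.

Section Manifold.
Variables (R : realType) (M : manifold4 R).

Definition img (a : chart M) : set 'rV[R]_4 := coord a @` dom a.

(* The part of [img a] where [transition a b] is defined. *)
Definition overlap (a b : chart M) : set 'rV[R]_4 :=
  coord a @` (dom a `&` dom b).

Definition transition (a b : chart M) : 'rV[R]_4 -> 'rV[R]_4 :=
  fun x => coord b (param a x).

(* d x_b^k / d x_a^i *)
Definition dtrans (a b : chart M) (k i : 'I_4) : 'rV[R]_4 -> R :=
  partial i (fun x => transition a b x ord0 k).

(* Tensor fields on M are families of components, one for each chart, which
   are smooth and obey the tensorial transformation law. *)
Definition is_vector_field (V : chart M -> vector_field R) : Prop :=
  (forall a i, smooth_on (img a) (fun x => V a x ord0 i)) /\
  (forall a b x, overlap a b x -> forall k,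
     V b (transition a b x) ord0 k
     = \sum_(i < 4) dtrans a b k i x * V a x ord0 i).

Definition is_metric (g : chart M -> matrix_field R) : Prop :=
  [/\ forall a i j, smooth_on (img a) (fun x => g a x i j),
      forall a b x, overlap a b x -> forall i j,
        g a x i j = \sum_(k < 4) \sum_(l < 4)
          dtrans a b k i x * dtrans a b l j x * g b (transition a b x) k l,
      forall a x, img a x -> forall i j, g a x i j = g a x j i
    & forall a x, img a x -> forall v : 'rV[R]_4, v != 0 ->
        0 < \sum_(i < 4) \sum_(j < 4) g a x i j * v ord0 i * v ord0 j].

(* An integrable almost complex structure. *)
Definition is_complex_structure (J : chart M -> matrix_field R) : Prop :=
  [/\ forall a i j, smooth_on (img a) (fun x => J a x i j),
      forall a b x, overlap a b x -> forall i j,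
        \sum_(k < 4) dtrans a b i k x * J a x k j
        = \sum_(k < 4) J b (transition a b x) i k * dtrans a b k j x,
      forall a x, img a x -> J a x *m J a x = - 1%:M
    & forall a x, img a x -> forall k i j, nijenhuis (J a) k i j x = 0].

Definition is_kahler (J g : chart M -> matrix_field R) : Prop :=
  [/\ is_complex_structure J,
      is_metric g,
      forall a x, img a x -> (J a x)^T *m g a x *m J a x = g a x
    & forall a x, img a x -> forall s, ext_d (kahler_form (g a) (J a)) x s = 0].

Definition scalar_flat (g : chart M -> matrix_field R) : Prop :=
  forall a x, img a x -> scalar_curvature (g a) x = 0.

Definition is_killing (g : chart M -> matrix_field R)
    (V : chart M -> vector_field R) : Prop :=
  forall a x, img a x -> forall s, lie (V a) (metric_tensor (g a)) x s = 0.

Definition is_symplectomorphic (J g : chart M -> matrix_field R)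
    (V : chart M -> vector_field R) : Prop :=
  forall a x, img a x -> forall s,
    lie (V a) (kahler_form (g a) (J a)) x s = 0.

(* The flow of V is an action of the circle R / 2 pi Z; in particular V is
   complete and its orbits are closed. *)
Definition generates_circle_action (V : chart M -> vector_field R) : Prop :=
  exists theta : R -> M -> M,
    [/\ continuous (fun tp : R * M => theta tp.1 tp.2),
        forall p, theta 0 p = p,
        forall t t' p, theta (t + t') p = theta t (theta t' p),
        forall p, theta (2 * pi) p = p
      & forall a p t, dom a (theta t p) ->
          is_derive t (1 : R) (fun t' => coord a (theta t' p))
            (V a (coord a (theta t p)))].

End Manifold.

(* Main.v *)
Require Import Defs.
From HB Require Import structures.
From mathcomp Require Import all_boot all_order all_algebra all_fingroup.
From mathcomp Require Import all_classical all_reals all_analysis.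
From mathcomp Require Import ring.
Import Order.TTheory GRing.Theory Num.Theory.
Import numFieldNormedType.Exports.
Local Open Scope classical_set_scope.
Local Open Scope ring_scope.

Set Implicit Arguments.
Unset Strict Implicit.
Unset Printing Implicit Defensive.

(** Write omega for the fundamental form and rho(X, Y) = - tr (J R(X, Y)), which
    is - 2 Ric(JX, Y). Put zeta = - i_V omega, tau = dV_flat, N = |V|^2 and
    h = Lambda tau, so that tau /\ omega = h vol, and let Z = - JV be the vector
    field dual to zeta. In the theorem, zeta is dz and h is the Laplacian of z.

    The closed (1,1)-forms omega, tau and rho have z, N and h as moment maps:
    dz = - i_V omega, dN = - i_V tau and dh = - i_V rho ([der_nrm2],
    [der_lap]). The last equation is Kostant's identity nabla_X (nabla V) =
    R(X, V) traced against J, and uses that J is parallel ([cpx_parallel]).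
    Vanishing scalar curvature means that rho /\ omega = 0 ([wedge_rho]), which
    also gives rho /\ rho = - 2 |Ric|^2 vol ([wedge_rho_rho]). The theorem therefore asks
    for a primitive of - rho /\ rho where V does not vanish. Equivariant
    localisation of the equivariantly closed form (rho + h)^2 gives one,
    V_flat /\ ((h / N)^2 tau - 2 (h / N) rho).
    Its differential is found from the moment map equations and from
    i_V a /\ V_flat /\ b + i_V b /\ V_flat /\ a = - N a /\ b, valid for 2-forms
    in dimension four because a /\ V_flat /\ b is a 5-form ([contract_5form],
    [der_primitive]).

    The form in the theorem is this primitive ([primitiveE]). With F = h^2 / N,
    the field Z / N contracts F V_flat /\ dVol2 = F V_flat /\ omega to zero, so
    that Cartan's formula gives the Lie derivative ([lie_gamE]). Further
    J df = - i_Z s for a moment map f of a closed (1,1)-form s, so that J dF is a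
    combination of i_Z rho and i_Z tau; contracting rho /\ omega = 0 and
    tau /\ omega = h vol with Z brings the sum to the form above.

    All this is algebra in a commutative ring with four commuting derivations in
    which N and the determinant of g are invertible. The geometry is developed
    there ([kahler_data]), and applied to the ring of smooth functions on the part
    of a chart where V does not vanish ([sfun]), where [schwarz] makes the partial
    derivatives commute. What remains is to identify the operators on tensor
    fields, defined by sums over permutations and index functions, with their
    components in that ring ([rep] and [local_identities]). *)

(** * Linear algebra over a commutative ring *)

Definition o0 : 'I_4 := @Ordinal 4 0 isT.
Definition o1 : 'I_4 := @Ordinal 4 1 isT.
Definition o2 : 'I_4 := @Ordinal 4 2 isT.
Definition o3 : 'I_4 := @Ordinal 4 3 isT.

Lemma sum4 (W : nmodType) (F : 'I_4 -> W) :
  \sum_(i < 4) F i = F o0 + F o1 + F o2 + F o3.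
Proof.
rewrite !big_ord_recr /= big_ord0 add0r.
by congr (F _ + F _ + F _ + F _); apply/val_inj.
Qed.

(** [mxD] to [trN], [trcD], [trcN] and the rules of [MatrixRules] are library
    facts restricted to commutative rings and, for [mxE], to one operation at a
    time: rewriting with the general ones infers a structure at every
    occurrence, and unfolds too much. *)
Lemma mxD (A : comNzRingType) m n (M N : 'M[A]_(m, n)) p q :
  (M + N) p q = M p q + N p q.
Proof. by rewrite mxE. Qed.

Lemma mxN (A : comNzRingType) m n (M : 'M[A]_(m, n)) p q : (- M) p q = - M p q.
Proof. by rewrite mxE. Qed.

Lemma mx0 (A : comNzRingType) m n p q : (0 : 'M[A]_(m, n)) p q = 0.
Proof. by rewrite mxE. Qed.

Lemma mxZ (A : comNzRingType) m n c (M : 'M[A]_(m, n)) p q :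
  (c *: M) p q = c * M p q.
Proof. by rewrite mxE. Qed.

Lemma trE (A : comNzRingType) m n (M : 'M[A]_(m, n)) p q : M^T p q = M q p.
Proof. by rewrite mxE. Qed.

Lemma mulE (A : comNzRingType) m n r (M : 'M[A]_(m, n)) (N : 'M[A]_(n, r)) p q :
  (M *m N) p q = \sum_j M p j * N j q.
Proof. by rewrite mxE. Qed.

Lemma trD (A : comNzRingType) m n (M N : 'M[A]_(m, n)) : (M + N)^T = M^T + N^T.
Proof. by apply/matrixP => p q; rewrite !mxE. Qed.

Lemma trN (A : comNzRingType) m n (M : 'M[A]_(m, n)) : (- M)^T = - M^T.
Proof. by apply/matrixP => p q; rewrite !mxE. Qed.

(** [lc1], [lc2], [mlc1] and [lc_double] deduce an equation from known ones by
    giving the linear combination that produces it; a ring tactic checks the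
    combination. *)
Lemma lc1 (A : comNzRingType) (x y a b : A) :
  a = b -> x - y = a - b -> x = y.
Proof. by move=> -> /eqP; rewrite subrr subr_eq0 => /eqP. Qed.

Lemma lc2 (A : comNzRingType) (x y a b c d : A) :
  a = b -> c = d -> x - y = (a - b) + (c - d) -> x = y.
Proof. by move=> -> -> /eqP; rewrite !subrr addr0 subr_eq0 => /eqP. Qed.

Lemma mlc1 (A : comNzRingType) m n (x y a b : 'M[A]_(m, n)) :
  a = b -> x - y = a - b -> x = y.
Proof. by move=> -> /eqP; rewrite subrr subr_eq0 => /eqP. Qed.

Lemma tr_sym_skew (A : comNzRingType) n (S K : 'M[A]_n) :
  S^T = S -> K^T = - K -> \tr (S *m K) = - \tr (S *m K).
Proof.
move=> s k; rewrite -{1}mxtrace_tr trmx_mul s k mulNmx linearN /=.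
by rewrite mxtrace_mulC.
Qed.

Lemma trcD (A : comNzRingType) n (M N : 'M[A]_n) :
  \tr (M + N) = \tr M + \tr N.
Proof. exact: mxtraceD. Qed.

Lemma trcN (A : comNzRingType) n (M : 'M[A]_n) : \tr (- M) = - \tr M.
Proof. exact: raddfN. Qed.

Lemma addrr_eq0 (A : comNzRingType) (c a : A) :
  c + c = 1 -> a + a = 0 -> a = 0.
Proof. by move=> c2 a2; rewrite -[a]mul1r -c2 mulrDl -mulrDr a2 mulr0. Qed.

Lemma lc_double (A : comNzRingType) (c x y a b : A) : c + c = 1 ->
  a = b -> (x - y) + (x - y) = a - b -> x = y.
Proof.
by move=> c2 ->; rewrite subrr => /(addrr_eq0 c2) /eqP; rewrite subr_eq0 => /eqP.
Qed.

Section MatrixRules.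
Variables (A : comNzRingType) (m n r q : nat).

Lemma mmDl (M N : 'M[A]_(m, n)) (P : 'M[A]_(n, r)) :
  (M + N) *m P = M *m P + N *m P.
Proof. exact: mulmxDl. Qed.

Lemma mmDr (P : 'M[A]_(m, n)) (M N : 'M[A]_(n, r)) :
  P *m (M + N) = P *m M + P *m N.
Proof. exact: mulmxDr. Qed.

Lemma mmNl (M : 'M[A]_(m, n)) (P : 'M[A]_(n, r)) : (- M) *m P = - (M *m P).
Proof. exact: mulNmx. Qed.

Lemma mmNr (M : 'M[A]_(m, n)) (P : 'M[A]_(n, r)) : M *m (- P) = - (M *m P).
Proof. exact: mulmxN. Qed.

Lemma mmA (M : 'M[A]_(m, n)) (P : 'M[A]_(n, r)) (Q : 'M[A]_(r, q)) :
  M *m (P *m Q) = M *m P *m Q.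
Proof. exact: mulmxA. Qed.

Lemma trM (M : 'M[A]_(m, n)) (P : 'M[A]_(n, r)) : (M *m P)^T = P^T *m M^T.
Proof. exact: trmx_mul. Qed.
End MatrixRules.

(** Identities between noncommutative polynomials in matrices: after expansion,
    each entry is an identity between the entries of the monomials. *)
Ltac mxring :=
  rewrite ?(mmDl, mmDr, mmNl, mmNr, mmA, trM, trD, trN, trmxK);
  apply/matrixP => ? ?; rewrite ?(mxD, mxN, mx0);
  repeat match goal with |- context [?t] =>
    lazymatch t with fun_of_matrix _ _ _ => generalize t; intro end end;
  ring.

(** * Kaehler geometry over a ring with four commuting derivations *)

(** The derivations stand for the partial derivatives of a chart. The inverse of
    2 is part of the structure because symmetry arguments give twice the wanted
    identity. *)
Record derivations (A : comNzRingType) := Derivations {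
  der :> 'I_4 -> A -> A;
  half : A;
  half2 : half + half = 1;
  derD : forall i a b, der i (a + b) = der i a + der i b;
  derM : forall i a b, der i (a * b) = der i a * b + a * der i b;
  derC : forall i j a, der i (der j a) = der j (der i a)
}.

(** These operators are locked: conversion between matrix expressions would
    otherwise unfold them. *)
HB.lock Definition Dm (A : comNzRingType) (D : derivations A) m n i
  (M : 'M[A]_(m, n)) : 'M[A]_(m, n) := map_mx (D i) M.

(** [christ i] has entry Gamma^k_ij in row k and column j, so that the covariant
    derivative of vectors in the direction i is [D i] plus the matrix
    [christ i]. *)
HB.lock Definition christ (A : comNzRingType) (D : derivations A)
    (g G : 'M[A]_4) (i : 'I_4) : 'M[A]_4 :=
  \matrix_(k, j) (half D * \sum_l G k l *
     (D i (g j l) + D j (g i l) - D l (g i j))).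

(** The endomorphism R(d_i, d_j). *)
HB.lock Definition curv (A : comNzRingType) (D : derivations A)
    (Gam : 'I_4 -> 'M[A]_4) (i j : 'I_4) : 'M[A]_4 :=
  Dm D i (Gam j) - Dm D j (Gam i) + Gam i *m Gam j - Gam j *m Gam i.

HB.lock Definition ric (A : comNzRingType) (D : derivations A)
    (Gam : 'I_4 -> 'M[A]_4) : 'M[A]_4 :=
  \matrix_(j, k) \sum_i curv D Gam i j i k.

Section Derivations.
Variables (A : comNzRingType) (D : derivations A).
Local Notation Dm := (Dm D).

Lemma der0 i : D i 0 = 0.
Proof. by apply/(addrI (D i 0)); rewrite -derD !addr0. Qed.

Lemma derN i a : D i (- a) = - D i a.
Proof. by apply/(addrI (D i a)); rewrite -derD !subrr der0. Qed.

Lemma derB i a b : D i (a - b) = D i a - D i b.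
Proof. by rewrite derD derN. Qed.

Lemma der1 i : D i 1 = 0.
Proof.
apply/(addrI (D i 1)); rewrite addr0 -{3}[1]mulr1 derM mulr1 mul1r //.
Qed.

Lemma der_sum i n (F : 'I_n -> A) :
  D i (\sum_j F j) = \sum_j D i (F j).
Proof. exact: (big_morph (D i) (derD D i) (der0 i)). Qed.

Lemma DmE m n i (M : 'M[A]_(m, n)) p q : Dm i M p q = D i (M p q).
Proof. by rewrite Dm.unlock mxE. Qed.

Lemma DmM m n r i (M : 'M[A]_(m, n)) (N : 'M[A]_(n, r)) :
  Dm i (M *m N) = Dm i M *m N + M *m Dm i N.
Proof.
apply/matrixP => p q; rewrite !(mxE, DmE) der_sum -big_split.
by apply: eq_bigr => j _; rewrite /= derM !(mxE, DmE).
Qed.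

Lemma DmD m n i (M N : 'M[A]_(m, n)) : Dm i (M + N) = Dm i M + Dm i N.
Proof. by apply/matrixP => p q; rewrite !(mxE, DmE) derD. Qed.

Lemma DmN m n i (M : 'M[A]_(m, n)) : Dm i (- M) = - Dm i M.
Proof. by apply/matrixP => p q; rewrite !(mxE, DmE) derN. Qed.

Lemma DmT m n i (M : 'M[A]_(m, n)) : Dm i M^T = (Dm i M)^T.
Proof. by apply/matrixP => p q; rewrite !(mxE, DmE). Qed.

Lemma DmC m n i j (M : 'M[A]_(m, n)) : Dm i (Dm j M) = Dm j (Dm i M).
Proof. by apply/matrixP => p q; rewrite !(mxE, DmE) derC. Qed.

Lemma Dm1 i : Dm i (1%:M : 'M[A]_4) = 0.
Proof.
by apply/matrixP => p q; rewrite !(mxE, DmE); case: eqP => _; rewrite ?der1 ?der0.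
Qed.

Lemma der_tr i (M : 'M[A]_4) : D i (\tr M) = \tr (Dm i M).
Proof. by rewrite /mxtrace der_sum; apply: eq_bigr => j _; rewrite DmE. Qed.

(** The hypotheses of the theorem, read in one chart: compatible metric, its
    inverse, complex structure and Killing field, with omega closed, vanishing
    Nijenhuis tensor and vanishing scalar curvature. Here [fund] is omega. *)
Record kahler_data := KahlerData {
  met : 'M[A]_4;
  imet : 'M[A]_4;
  cpx : 'M[A]_4;
  vec : 'I_4 -> A;
  met_sym : met^T = met;
  imetK : imet *m met = 1%:M;
  cpx2 : cpx *m cpx = - 1%:M;
  cpx_orth : cpx^T *m met *m cpx = met;
  fund := cpx^T *m met;
  fund_closed : forall i j k,
    D i (fund j k) + D j (fund k i) + D k (fund i j) = 0;
  cpx_int : forall k i j, \sum_l (cpx l i * D l (cpx k j)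
      - cpx l j * D l (cpx k i)
      + cpx k l * D j (cpx l i) - cpx k l * D i (cpx l j)) = 0;
  vec_killing : forall i j, \sum_k vec k * D k (met i j)
      + \sum_k D i (vec k) * met k j + \sum_k D j (vec k) * met i k = 0;
  vec_sympl : forall i j, \sum_k vec k * D k (fund i j)
      + \sum_k D i (vec k) * fund k j + \sum_k D j (vec k) * fund i k = 0;
  scal0 : \sum_i \sum_j imet i j * ric D (christ D met imet) i j = 0
}.

End Derivations.

Section Kahler.
Variables (A : comNzRingType) (D : derivations A) (X : kahler_data D).
Local Notation g := (met X).
Local Notation G := (imet X).
Local Notation J := (cpx X).
Local Notation V := (vec X).
Local Notation Om := (fund X).
Local Notation Dm := (Dm D).

Local Notation Gam := (christ D g G).

Lemma christ_sym i j k : Gam i k j = Gam j k i.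
Proof.
rewrite christ.unlock !mxE; congr (_ * _).
apply: eq_bigr => l _; congr (_ * _).
have /matrixP/(_ i j) := met_sym X; rewrite mxE => ->; ring.
Qed.

Lemma gE i j : g i j = g j i.
Proof. by rewrite -{1}(met_sym X) mxE. Qed.

Lemma metK : g *m G = 1%:M.
Proof. exact: mulmx1C (imetK X). Qed.

Lemma imet_sym : G^T = G.
Proof.
rewrite -[LHS]mulmx1 -metK mmA -{1}(met_sym X) -trM metK.
by rewrite trmx1 mul1mx.
Qed.

Lemma met_christ i l j :
  (g *m Gam i) l j = half D * (D i (g j l) + D j (g i l) - D l (g i j)).
Proof.
pose E := \col_l (half D * (D i (g j l) + D j (g i l) - D l (g i j))).
have -> : (g *m Gam i) l j = (g *m (G *m E)) l 0.
  rewrite !mulE; apply: eq_bigr => k _; congr (_ * _).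
  rewrite christ.unlock !mxE mulr_sumr; apply: eq_bigr => m _.
  rewrite mxE; ring.
by rewrite mmA metK mul1mx mxE.
Qed.

Lemma met_parallel i : Dm i g = (Gam i)^T *m g + g *m Gam i.
Proof.
apply/matrixP => j l; rewrite mxD DmE.
have -> : ((Gam i)^T *m g) j l = (g *m Gam i) l j.
  by rewrite -(trE ((Gam i)^T *m g)) trM trmxK met_sym.
rewrite !met_christ (gE l j) -mulrDr -[LHS]mul1r -(half2 D); ring.
Qed.

Lemma fundE : Om = - (g *m J).
Proof.
rewrite /fund -[LHS]mulmx1 -[X in _ *m X = _]opprK -(cpx2 X) mmNr mmA.
by rewrite (cpx_orth X).
Qed.

Lemma fund_skew : Om^T = - Om.
Proof. by rewrite {2}fundE opprK /fund trM trmxK met_sym. Qed.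

Lemma trJg : J^T *m g = - (g *m J).
Proof. exact: fundE. Qed.

Lemma met_cpx_skew : (g *m J)^T = - (g *m J).
Proof. by rewrite trM met_sym trJg. Qed.

(** The covariant derivative of the complex structure. *)
Let a i : 'M[A]_4 := Dm i J + Gam i *m J - J *m Gam i.

Let Dm_gJ i : Dm i (g *m J) = (Gam i)^T *m (g *m J) + g *m J *m Gam i
  + g *m a i.
Proof. by rewrite DmM met_parallel /a; mxring. Qed.

Let ga_skew i : (g *m a i)^T = - (g *m a i).
Proof.
have e : g *m a i = Dm i (g *m J) - (Gam i)^T *m (g *m J) - g *m J *m Gam i.
  by rewrite Dm_gJ; mxring.
have s : (g *m J)^T = - (g *m J) by rewrite trM met_sym trJg.
rewrite e !(trD, trN) -DmT s DmN trM s trM s.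
by rewrite trmxK; mxring.
Qed.

Let aJ i : a i *m J = - (J *m a i).
Proof.
have : Dm i (J *m J) = 0 by rewrite cpx2 DmN Dm1 oppr0.
rewrite DmM => e.
have -> : a i *m J = - (J *m a i) + (Dm i J *m J + J *m Dm i J)
   + Gam i *m (J *m J) - J *m J *m Gam i.
  by rewrite /a; mxring.
by rewrite e cpx2 mmNl mmNr mul1mx mulmx1; mxring.
Qed.

Let a_closed i j k :
  (g *m a i) j k + (g *m a j) k i + (g *m a k) i j = 0.
Proof.
have e l : g *m a l = Dm l (g *m J) - (Gam l)^T *m (g *m J) - g *m J *m Gam l.
  by rewrite Dm_gJ; mxring.
have := fund_closed X i j k; rewrite fundE !mxN !derN => f.
have s p q : (g *m J) p q = - (g *m J) q p.
  by rewrite -{1}[g *m J]opprK -fundE mxN -trE fund_skew fundE opprK.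
rewrite !e !(mxD, mxN, DmE).
have h l p q : ((Gam l)^T *m (g *m J)) p q + (g *m J *m Gam l) p q
  = \sum_m (Gam l m p * (g *m J) m q - Gam l m q * (g *m J) m p).
  rewrite !mulE -big_split; apply: eq_bigr => m _ /=.
  by rewrite trE (s p m); ring.
have h' : (((Gam i)^T *m (g *m J)) j k + (g *m J *m Gam i) j k)
 + (((Gam j)^T *m (g *m J)) k i + (g *m J *m Gam j) k i)
 + (((Gam k)^T *m (g *m J)) i j + (g *m J *m Gam k) i j) = 0.
  rewrite !h -!big_split big1 // => m _ /=.
  by rewrite (christ_sym j i m) (christ_sym k i m) (christ_sym k j m); ring.
by apply: (lc2 (esym f) (esym h')); ring.
Qed.

(** The Nijenhuis tensor may be computed with covariant derivatives, as the
    connection is torsion-free. *)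
Let a_int k i j : \sum_l (J l i * a l k j - J l j * a l k i
    + J k l * a j l i - J k l * a i l j) = 0.
Proof.
pose b p := Gam p *m J - J *m Gam p.
have aE p q r : a p q r = D p (J q r) + b p q r.
  by rewrite /a /b !(mxD, mxN, DmE) addrA.
suff b0 : \sum_l (J l i * b l k j - J l j * b l k i
    + J k l * b j l i - J k l * b i l j) = 0.
  have := congr2 +%R (cpx_int X k i j) b0; rewrite addr0 -big_split.
  apply: etrans.
  by apply: eq_bigr => l _ /=; rewrite !aE; ring.
pose S p q := \sum_l J l p * (Gam l *m J) k q.
have S_sym p q : S p q = S q p.
  rewrite /S; under eq_bigr do rewrite mulE mulr_sumr.
  rewrite exchange_big; apply: eq_bigr => l _ /=; rewrite mulE mulr_sumr.
  by apply: eq_bigr => m _; rewrite (christ_sym l m k); ring.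
have first p q : \sum_l J l p * b l k q = S p q - (J *m Gam q *m J) k p.
  rewrite -mmA mulE; under [in RHS]eq_bigr do rewrite mulE mulr_sumr.
  rewrite exchange_big -sumrB; apply: eq_bigr => l _ /=.
  rewrite /b mxD mxN mulrBr [(J *m Gam l) k q]mulE mulr_sumr.
  congr (_ - _); apply: eq_bigr => m _; rewrite (christ_sym l q m); ring.
have third p q : \sum_l J k l * b p l q = (J *m Gam p *m J) k q + Gam p k q.
  rewrite -mulE /b mmDr mmNr !mmA cpx2 mmNl mul1mx opprK mxD //.
rewrite sumrB big_split /= sumrB !first !third (S_sym j i).
by rewrite (christ_sym j i k); ring.
Qed.

Let P i j k := \sum_m J m i * (g *m a m) k j.
Let Q i j k := (g *m a j *m J) k i.

(** As [g *m a l] is skew, closedness of omega expresses the derivative of J in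
    the direction J d_i by derivatives in coordinate directions. *)
Let PQ i j k : P i j k - Q i j k + Q i k j = 0.
Proof.
rewrite /P /Q !mulE -!sumrB -big_split big1 // => m _ /=.
have gT p q r : (g *m a p) q r = - (g *m a p) r q.
  by rewrite -mxN -ga_skew trE.
have e := a_closed m k j; rewrite (gT j m k) in e.
by apply: (lc1 (congr1 ( *%R (J m i)) e)); ring.
Qed.

(** [PQ] turns the vanishing of the Nijenhuis tensor into the vanishing of twice
    [Q], the lowered derivative of J composed with J. *)
Lemma cpx_parallel i : Dm i J = J *m Gam i - Gam i *m J.
Proof.
suff a0 : a i = 0 by have := congr2 +%R a0 (erefl (J *m Gam i - Gam i *m J));
  rewrite add0r => <-; rewrite /a; mxring.
have gaJ_skew j : (g *m a j *m J)^T = - (g *m a j *m J).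
  rewrite trM ga_skew mmNr mmA trJg mmNl opprK -!mmA aJ mmNr opprK //.
have Q_skew j p q : Q p j q = - Q q j p.
  by rewrite /Q -mxN -gaJ_skew trE.
have Q0 p j k : Q p j k = 0.
  apply: (addrr_eq0 (half2 D)).
  have n0 : \sum_l g j l * (\sum_m (J m k * a m l p - J m p * a m l k
    + J l m * a p m k - J l m * a k m p)) = 0.
    by rewrite big1 // => l _; rewrite a_int mulr0.
  have PE x y z : \sum_l g z l * (\sum_m J m x * a m l y) = P x y z.
    rewrite /P; under eq_bigr do rewrite mulr_sumr.
    rewrite exchange_big; apply: eq_bigr => m _ /=.
    by rewrite mulE mulr_sumr; apply: eq_bigr => l _; ring.
  have QE x y z : \sum_l g z l * (\sum_m J l m * a y m x) = - Q x y z.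
    rewrite /Q -mmA aJ mmNr mxN opprK mulE.
    by apply: eq_bigr => l _; rewrite mulE.
  move: n0; under eq_bigr do rewrite sumrB big_split sumrB mulrBr mulrDr mulrBr.
  rewrite sumrB big_split sumrB /= !PE !QE => n0.
  have e1 := PQ k p j; have e2 := PQ p k j.
  rewrite (Q_skew j k p) in e1.
  apply: (lc2 (congr2 +%R e2 (esym e1)) n0).
  ring.
have gaJ0 : g *m a i *m J = 0.
  by apply/matrixP => p q; rewrite mx0 -(Q0 q i p).
have ga0 : g *m a i = 0.
  by rewrite -[LHS]mulmx1 -[1%:M]opprK -(cpx2 X) mmNr mmA gaJ0 mul0mx oppr0.
by rewrite -[a i]mul1mx -(imetK X) -mmA ga0 mulmx0.
Qed.

Local Notation R := (curv D Gam).
Local Notation Rc := (ric D Gam).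

Lemma curvN i j : R i j = - R j i.
Proof. by rewrite curv.unlock; mxring. Qed.

(** Commute two derivatives of the parallel tensor g; [curv_cpx] does the same
    for J. *)
Lemma curv_skew i j : (g *m R i j)^T = - (g *m R i j).
Proof.
have e p q : Dm p (Dm q g) = (Dm p (Gam q))^T *m g
    + (Gam q)^T *m ((Gam p)^T *m g + g *m Gam p)
    + (((Gam p)^T *m g + g *m Gam p) *m Gam q + g *m Dm p (Gam q)).
  by rewrite met_parallel DmD !DmM DmT met_parallel.
have h := DmC D i j g; rewrite !e in h; apply: (mlc1 h).
by rewrite trM met_sym curv.unlock; mxring.
Qed.

Lemma curv_cpx i j : R i j *m J = J *m R i j.
Proof.
have e p q : Dm p (Dm q J) = (J *m Gam p - Gam p *m J) *m Gam q
   + J *m Dm p (Gam q)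
   - (Dm p (Gam q) *m J + Gam q *m (J *m Gam p - Gam p *m J)).
  by rewrite cpx_parallel DmD DmN !DmM cpx_parallel.
have h := DmC D j i J; rewrite !e in h; apply: (mlc1 h).
by rewrite curv.unlock; mxring.
Qed.

Lemma bianchi1 i j k p : R i j p k + R j k p i + R k i p j = 0.
Proof.
have s x y z : (Gam x *m Gam y) p z = (Gam x *m Gam z) p y.
  by rewrite !mulE; apply: eq_bigr => m _; rewrite (christ_sym y z).
rewrite curv.unlock !(mxD, mxN, DmE) (christ_sym k j) (christ_sym k i).
by rewrite (christ_sym j i) (s k j i) (s i k j) (s j k i); ring.
Qed.

Let DR k i j := Dm k (R i j) + Gam k *m R i j - R i j *m Gam k.

(** The Jacobi identity for the covariant derivatives. *)
Lemma bianchi2 i j k : DR k i j + DR i j k + DR j k i = 0.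
Proof.
rewrite /DR curv.unlock !(DmD, DmN, DmM) (DmC D k i) (DmC D k j) (DmC D j i).
by mxring.
Qed.

(** Twice the Ricci form up to sign (see [rhoE]). This expression makes it
    closed for a formal reason: it is the trace of the curvature against a
    parallel tensor. *)
Definition rho : 'M[A]_4 := \matrix_(i, j) - \tr (J *m R i j).

Lemma rho_closed i j k : D k (rho i j) + D i (rho j k) + D j (rho k i) = 0.
Proof.
have e p x y : D p (rho x y) = - \tr (J *m DR p x y).
  rewrite mxE derN der_tr DmM cpx_parallel /DR; congr (- _).
  rewrite mmDl mmNl !mmDr mmNr !mmA !(trcD, trcN) -[Gam p *m J *m _]mmA.
  by rewrite [\tr (Gam p *m _)]mxtrace_mulC; ring.
by rewrite !e -!opprD -!trcD -!mmDr bianchi2 mulmx0 mxtrace0 oppr0.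
Qed.

Let Rl i j k l := (g *m R i j) l k.

Let RlN i j k l : Rl i j k l = - Rl j i k l.
Proof. by rewrite /Rl curvN mmNr mxN. Qed.

Let RlT i j k l : Rl i j k l = - Rl i j l k.
Proof. by rewrite /Rl -mxN -curv_skew trE. Qed.

Let Rl_bianchi i j k l : Rl i j k l + Rl j k i l + Rl k i j l = 0.
Proof.
rewrite /Rl !mulE -!big_split big1 // => p _ /=.
by rewrite -!mulrDr bianchi1 mulr0.
Qed.

(** The first Bianchi identities with each of the four indices held fixed are
    the faces of Milnor's octahedron. *)
Lemma curv_pair i j k l : Rl i j k l = Rl k l i j.
Proof.
have b1 := Rl_bianchi i j k l; have b2 := Rl_bianchi j k l i.
have b3 := Rl_bianchi k l i j; have b4 := Rl_bianchi l i j k.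
rewrite (RlT j k l i) (RlT k l j i) (RlT l j k i) in b2.
rewrite (RlT l i k j) (RlT i k l j) (RlN i k j l) in b3.
rewrite (RlT i j l k) in b4; rewrite (RlN j l i k) in b4.
apply: (lc_double (half2 D) (congr2 +%R (congr2 +%R b1 b2)
                     (congr1 -%R (congr2 +%R b3 b4)))).
by ring.
Qed.

(** By the pair symmetry, this is the commutation of the curvature with J. *)
Lemma curv_11 i j : \sum_b J b i *: R b j = - \sum_b J b j *: R i b.
Proof.
suff : g *m (\sum_b J b i *: R b j) = g *m (- \sum_b J b j *: R i b).
  by move/(congr1 (mulmx G)); rewrite !mmA imetK !mul1mx.
apply/matrixP => l k; rewrite mmNr mxN !linear_sum /= !summxE.
have -> : \sum_b (g *m (J b i *: R b j)) l k = (g *m R k l *m J) j i.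
  rewrite mulE; apply: eq_bigr => b _.
  by rewrite -scalemxAr mxE mulrC -[(g *m R b j) l k]/(Rl b j k l) curv_pair.
have -> : \sum_b (g *m (J b j *: R i b)) l k = (J^T *m (g *m R k l)) j i.
  rewrite mulE; apply: eq_bigr => b _.
  by rewrite -scalemxAr mxE trE -[(g *m R i b) l k]/(Rl i b k l) curv_pair.
by rewrite -mmA curv_cpx mmA [in RHS]mmA trJg mmNl mxN opprK.
Qed.

Lemma tr_curv i j : \tr (R i j) = 0.
Proof.
apply: (addrr_eq0 (half2 D)); rewrite -[R i j]mul1mx -(imetK X) -mmA.
by rewrite {1}(tr_sym_skew imet_sym (curv_skew i j)) addNr.
Qed.

Lemma ric_sym : Rc^T = Rc.
Proof.
apply/matrixP => k j; rewrite trE; apply/eqP; rewrite -subr_eq0; apply/eqP.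
have t : - \tr (R j k) = 0 by rewrite tr_curv oppr0.
rewrite ric.unlock !mxE -sumrB -[RHS]t /mxtrace -sumrN.
apply: eq_bigr => i _.
by rewrite (curvN i k) mxN; apply: (lc1 (bianchi1 i j k i)); ring.
Qed.

Lemma ric_cpx : Rc *m J = - (J^T *m Rc).
Proof.
apply/matrixP => j k; rewrite mxN !mulE.
have e p q : ric D Gam p q = \sum_i R i p i q by rewrite ric.unlock mxE.
under eq_bigr do rewrite e mulr_suml.
rewrite exchange_big -sumrN /=.
have -> : \sum_i \sum_m R i j i m * J m k
    = \sum_m (\sum_i J i m *: R i j) m k.
  under eq_bigr do rewrite -mulE curv_cpx mulE.
  rewrite exchange_big; apply: eq_bigr => m _; rewrite summxE.
  by apply: eq_bigr => i _; rewrite mxE.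
rewrite (eq_bigr (fun m => (- \sum_b J b j *: R m b) m k)); last first.
  by move=> m _; exact: (congr1 (fun M : 'M[A]_4 => M m k) (curv_11 m j)).
under eq_bigr do rewrite mxN summxE.
rewrite sumrN exchange_big -sumrN; apply: eq_bigr => m _.
by rewrite trE e mulr_sumr; congr (- _); apply: eq_bigr => i _; rewrite mxE.
Qed.

(** The first Bianchi identity turns the trace of J R(d_i, d_j) into two traces
    that define Ric. *)
Lemma rhoE : rho = - (J^T *m Rc + J^T *m Rc).
Proof.
have Jsum p q : \sum_b (J *m R b p) b q = (Rc *m J) p q.
  rewrite mulE ric.unlock; under [RHS]eq_bigr do rewrite mxE mulr_suml.
  rewrite exchange_big; apply: eq_bigr => b _.
  by rewrite -curv_cpx mulE.
have tJ : (Rc *m J)^T = - (Rc *m J).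
  by rewrite trM ric_sym ric_cpx opprK.
apply/matrixP => i j; rewrite mxE mxN mxD -[J^T *m Rc]opprK -ric_cpx mxN.
have -> : \tr (J *m R i j) = (Rc *m J) j i - (Rc *m J) i j.
  rewrite -!Jsum -sumrB; apply: eq_bigr => b _; rewrite !mulE -sumrB.
  apply: eq_bigr => m _; rewrite -mulrBr; congr (_ * _).
  have e := bianchi1 i j b m; rewrite (curvN j b) mxN in e.
  by apply: (lc1 e); ring.
by rewrite -(trE _ i j) tJ mxN; ring.
Qed.

Lemma rho_skew : rho^T = - rho.
Proof.
have tJ : (J^T *m Rc)^T = - (J^T *m Rc) by rewrite trM trmxK ric_sym ric_cpx.
by rewrite rhoE trN trD tJ; mxring.
Qed.

Lemma rho_11 : J^T *m rho *m J = rho.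
Proof.
have e : J^T *m (J^T *m Rc) *m J = J^T *m Rc.
  rewrite -!mmA ric_cpx !mmNr [X in - X]mmA -trM cpx2 trN trmx1.
  by rewrite mmNl mul1mx opprK.
by rewrite rhoE mmNr mmNl mmDr mmDl e.
Qed.

(** The covariant derivative of V, as an endomorphism. *)
Definition cov_vec : 'M[A]_4 :=
  \matrix_(k, j) (D j (V k) + \sum_m Gam j k m * V m).
Local Notation K := cov_vec.

Lemma cov_vecE k j : K k j = D j (V k) + \sum_m Gam j k m * V m.
Proof. by rewrite mxE. Qed.

Lemma cov_skew : (g *m K)^T = - (g *m K).
Proof.
suff h i j : (g *m K) i j + (g *m K) j i = 0.
  by apply/matrixP => p q; rewrite trE mxN; apply: (lc1 (h p q)); ring.
have KE p q : (g *m K) p q = \sum_k D q (V k) * g k p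
    + \sum_k V k * (g *m Gam k) p q.
  rewrite mulE; under eq_bigr do rewrite cov_vecE mulrDr mulr_sumr.
  rewrite big_split exchange_big /=; congr (_ + _).
    by apply: eq_bigr => k _; rewrite gE mulrC.
  apply: eq_bigr => k _; rewrite mulE mulr_sumr; apply: eq_bigr => m _.
  by rewrite (christ_sym q k); ring.
have := vec_killing X i j.
under eq_bigr do rewrite -DmE met_parallel mxD mulrDr.
rewrite big_split /= => e; rewrite !KE.
have e1 : \sum_k V k * ((Gam k)^T *m g) i j = \sum_k V k * (g *m Gam k) j i.
  apply: eq_bigr => k _; congr (_ * _).
  by rewrite -(trE ((Gam k)^T *m g)) trM trmxK met_sym.
have e2 : \sum_k D j (V k) * g i k = \sum_k D j (V k) * g k i.
  by apply: eq_bigr => k _; rewrite gE.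
by rewrite e1 e2 in e; apply: (lc1 e); ring.
Qed.

(** The Lie derivative of omega vanishes and omega is parallel. *)
Lemma cov_cpx : K *m J = J *m K.
Proof.
suff h i j : (g *m (J *m K)) i j - (g *m (K *m J)) i j = 0.
  have e : g *m (K *m J) = g *m (J *m K).
    by apply/matrixP => p q; apply/esym; apply: (lc1 (h p q)); ring.
  by rewrite -[LHS]mul1mx -(imetK X) -mmA e mmA imetK mul1mx.
have pgJ k : Dm k (g *m J) = (Gam k)^T *m (g *m J) + g *m J *m Gam k.
  by rewrite DmM met_parallel cpx_parallel; mxring.
have KE p q : (g *m J *m K) p q = \sum_k D q (V k) * (g *m J) p k
    + \sum_k V k * (g *m J *m Gam k) p q.
  rewrite mulE; under eq_bigr do rewrite cov_vecE mulrDr mulr_sumr.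
  rewrite big_split exchange_big /=; congr (_ + _).
    by apply: eq_bigr => k _; rewrite mulrC.
  apply: eq_bigr => k _; rewrite mulE mulr_sumr; apply: eq_bigr => m _.
  by rewrite (christ_sym q k); ring.
have sk p q : (g *m J) p q = - (g *m J) q p.
  by rewrite -{1}[g *m J]opprK -fundE mxN -trE fund_skew fundE opprK.
have := vec_sympl X i j; rewrite fundE.
under eq_bigr do rewrite mxN derN -DmE pgJ mxD mulrN mulrDr opprD.
under [X in _ + X + _]eq_bigr do rewrite mxN mulrN.
under [X in _ + X]eq_bigr do rewrite mxN mulrN.
rewrite big_split /= !sumrN => e.
have e1 : \sum_k V k * ((Gam k)^T *m (g *m J)) i j
   = - \sum_k V k * (g *m J *m Gam k) j i.
  rewrite -sumrN; apply: eq_bigr => k _; rewrite -mulrN; congr (_ * _).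
  rewrite -(trE ((Gam k)^T *m (g *m J))) trM trmxK -mxN -mmNl.
  by rewrite met_cpx_skew.
have e2 : \sum_k D i (V k) * (g *m J) k j
   = - \sum_k D i (V k) * (g *m J) j k.
  by rewrite -sumrN; apply: eq_bigr => k _; rewrite sk mulrN.
have e3 : (g *m (K *m J)) i j = (g *m J *m K) j i.
  rewrite mmA -(trE (g *m K *m J)) trM cov_skew mmNr mmA trJg.
  by rewrite mmNl opprK.
rewrite e3 mmA !KE; rewrite e1 e2 in e.
by apply: (lc1 (esym e)); ring.
Qed.

(** The covariant derivative T of nabla V is skew in two indices (V is a Killing
    field), and its antisymmetrisation in the first two is curvature applied to
    V. As for the Christoffel symbols, these two facts determine T. *)
Lemma kostant i :
  Dm i K + Gam i *m K - K *m Gam i = \sum_m V m *: R i m.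
Proof.
pose T p := Dm p K + Gam p *m K - K *m Gam p.
pose t p q r := (g *m T p) r q.
pose RV p q r := \sum_m V m * Rl p q m r.
have tN p q r : t p q r = - t p r q.
  have e : g *m T p = Dm p (g *m K) - (Gam p)^T *m (g *m K)
      - g *m K *m Gam p.
    by rewrite DmM met_parallel /T; mxring.
  have sk : (g *m T p)^T = - (g *m T p).
    rewrite e !(trD, trN) -DmT cov_skew DmN [((Gam p)^T *m _)^T]trM.
    rewrite [(g *m K *m Gam p)^T]trM cov_skew trmxK.
    by mxring.
  by rewrite /t -mxN -sk trE.
have tR p q r : t p q r - t q p r = RV p q r.
  have -> : RV p q r = \sum_s g r s * \sum_m R p q s m * V m.
    rewrite /RV; under [RHS]eq_bigr do rewrite mulr_sumr.
    rewrite exchange_big; apply: eq_bigr => m _ /=.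
    by rewrite /Rl mulE mulr_sumr; apply: eq_bigr => s _; ring.
  rewrite /t !mulE -sumrB; apply: eq_bigr => s _; rewrite -mulrBr.
  congr (_ * _).
  have KG x y : (K *m Gam x) s y = (K *m Gam y) s x.
    by rewrite !mulE; apply: eq_bigr => m _; rewrite (christ_sym x y).
  rewrite /T !(mxD, mxN, DmE) (KG q p) !cov_vecE !derD !der_sum (derC D q p).
  have e x y : \sum_m D x (Gam y s m * V m) + (Gam x *m K) s y
    = \sum_m (D x (Gam y s m) * V m + Gam y s m * D x (V m)
         + Gam x s m * D y (V m)) + \sum_m (Gam x *m Gam y) s m * V m.
    rewrite [(Gam x *m K) s y]mulE.
    under [X in _ + X]eq_bigr do rewrite cov_vecE mulrDr mulr_sumr.
    rewrite big_split exchange_big /= addrA -big_split /=; congr (_ + _).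
      by apply: eq_bigr => m _; rewrite derM.
    apply: eq_bigr => m _; rewrite mulE mulr_suml.
    by apply: eq_bigr => u _; rewrite mulrA.
  have -> : \sum_m R p q s m * V m
    = (\sum_m D p (Gam q s m * V m) + (Gam p *m K) s q)
      - (\sum_m D q (Gam p s m * V m) + (Gam q *m K) s p).
    rewrite !e -!big_split -sumrB; apply: eq_bigr => m _ /=.
    by rewrite curv.unlock !(mxD, mxN, DmE); ring.
  by ring.
have key p q r : t p q r = \sum_m V m * Rl p m q r.
  have two : RV p q r - RV q r p + RV r p q
     = \sum_m V m * Rl p m q r + \sum_m V m * Rl p m q r.
    rewrite /RV -sumrB -!big_split; apply: eq_bigr => m _ /=.
    have b := Rl_bianchi p q r m.
    rewrite (RlT p q r) (RlT q r p) (RlT r p q) in b.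
    rewrite (RlN p m) (curv_pair m p).
    by apply: (lc1 (congr1 (fun u => - (V m * u)) b)); ring.
  apply: (lc_double (half2 D) (congr2 +%R (congr2 +%R (tR p q r) (tR r p q))
     (congr1 -%R (tR q r p)))).
  rewrite (tN q p r) (tN r q p) (tN p r q).
  by apply: (lc1 two); ring.
suff e : g *m T i = g *m \sum_m V m *: R i m.
  by rewrite -/(T i) -[T i]mul1mx -(imetK X) -mmA e mmA imetK mul1mx.
apply/matrixP => r q; rewrite -[LHS]/(t i q r) key linear_sum summxE /=.
by apply: eq_bigr => m _; rewrite -scalemxAr mxE.
Qed.

(** The Laplacian of the Killing potential; it is defined without potential. *)
Definition lap : A := - \tr (J *m K).

(** [lap] is a moment map for [rho]: J is parallel and the derivative of nabla V
    is the curvature. *)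
Lemma der_lap i : D i lap = - \sum_m V m * rho m i.
Proof.
have -> : D i lap = - \tr (J *m (Dm i K + Gam i *m K - K *m Gam i)).
  rewrite /lap derN der_tr DmM cpx_parallel; congr (- _).
  rewrite mmDl mmNl !mmDr mmNr !mmA !(trcD, trcN) -[Gam i *m J *m _]mmA.
  by rewrite [\tr (Gam i *m _)]mxtrace_mulC; ring.
rewrite kostant linear_sum linear_sum /=; congr (- _); apply: eq_bigr => m _.
by rewrite -scalemxAr mxtraceZ mxE (curvN m) mmNr trcN opprK.
Qed.

End Kahler.

(** * Exterior algebra in dimension four *)

Lemma ord4_ind (P : 'I_4 -> Prop) :
  P o0 -> P o1 -> P o2 -> P o3 -> forall i, P i.
Proof.
move=> p0 p1 p2 p3 [[|[|[|[|//]]]] lt].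
- by have -> : Ordinal lt = o0 by exact: val_inj.
- by have -> : Ordinal lt = o1 by exact: val_inj.
- by have -> : Ordinal lt = o2 by exact: val_inj.
- by have -> : Ordinal lt = o3 by exact: val_inj.
Qed.

Section Forms.
Variable A : comNzRingType.
Variables (hf : A) (c2 : hf + hf = 1).

(** Components of wedge products; a 2-form is given by a skew matrix, and [pf] is
    half the square of a 2-form. *)
Definition wedge12 (a : 'I_4 -> A) (B : 'M[A]_4) i j k : A :=
  a i * B j k - a j * B i k + a k * B i j.

Definition wedge22 (B C : 'M[A]_4) i j k l : A :=
  B i j * C k l - B i k * C j l + B i l * C j k
  + B j k * C i l - B j l * C i k + B k l * C i j.

Definition wedge11 (a b : 'I_4 -> A) : 'M[A]_4 :=
  \matrix_(i, j) (a i * b j - a j * b i).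

Lemma wedge11E a b i j : wedge11 a b i j = a i * b j - a j * b i.
Proof. by rewrite mxE. Qed.

Definition pf (B : 'M[A]_4) i j k l : A :=
  B i j * B k l - B i k * B j l + B i l * B j k.

Lemma wedge22xx B i j k l : wedge22 B B i j k l = pf B i j k l + pf B i j k l.
Proof. by rewrite /wedge22 /pf; ring. Qed.

Lemma wedge22C B C i j k l : wedge22 B C i j k l = wedge22 C B i j k l.
Proof. by rewrite /wedge22; ring. Qed.

Definition alt4 (f : 'I_4 -> 'I_4 -> 'I_4 -> 'I_4 -> A) :=
  [/\ forall i j k l, f j i k l = - f i j k l,
      forall i j k l, f i k j l = - f i j k l &
      forall i j k l, f i j l k = - f i j k l].

Lemma alt4_0 f : alt4 f -> f o0 o1 o2 o3 = 0 -> forall i j k l, f i j k l = 0.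
Proof.
case=> f1 f2 f3 f0.
have e1 i k l : f i i k l = 0.
  by apply: (addrr_eq0 c2); rewrite {1}f1 addNr.
have e2 i j l : f i j j l = 0.
  by apply: (addrr_eq0 c2); rewrite {1}f2 addNr.
have e3 i j k : f i j k k = 0.
  by apply: (addrr_eq0 c2); rewrite {1}f3 addNr.
pose sort1 := (f1 o0 o1, f1 o0 o2, f1 o0 o3, f1 o1 o2, f1 o1 o3, f1 o2 o3).
pose sort2 := ((fun i => f2 i o0 o1), (fun i => f2 i o0 o2),
  (fun i => f2 i o0 o3), (fun i => f2 i o1 o2), (fun i => f2 i o1 o3),
  (fun i => f2 i o2 o3)).
pose sort3 := ((fun i j => f3 i j o0 o1), (fun i j => f3 i j o0 o2),
  (fun i j => f3 i j o0 o3), (fun i j => f3 i j o1 o2),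
  (fun i j => f3 i j o1 o3), (fun i j => f3 i j o2 o3)).
by do 4!elim/ord4_ind; rewrite ?(sort1, sort2, sort3, oppr0) ?(e1, e2, e3, f0)
  ?oppr0.
Qed.

Lemma alt4_eq f h : alt4 f -> alt4 h -> f o0 o1 o2 o3 = h o0 o1 o2 o3 ->
  forall i j k l, f i j k l = h i j k l.
Proof.
case=> f1 f2 f3 [h1 h2 h3] e i j k l; apply/eqP; rewrite -subr_eq0; apply/eqP.
apply: (@alt4_0 (fun i j k l => f i j k l - h i j k l)); last by rewrite e subrr.
split=> a b c d.
- by rewrite (f1 a b) (h1 a b); ring.
- by rewrite (f2 a b c) (h2 a b c); ring.
- by rewrite (f3 a b c d) (h3 a b c d); ring.
Qed.

Lemma skewE (B : 'M[A]_4) : B^T = - B -> forall i j, B j i = - B i j.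
Proof. by move=> s i j; rewrite -mxN -s trE. Qed.

Lemma wedge22_alt B C : B^T = - B -> C^T = - C -> alt4 (wedge22 B C).
Proof.
move=> /skewE b /skewE c; rewrite /wedge22; split=> i j k l.
- by rewrite (b i j) (c i j); ring.
- by rewrite (b j k) (c j k); ring.
- by rewrite (b k l) (c k l); ring.
Qed.

Lemma pf_alt B : B^T = - B -> alt4 (pf B).
Proof.
move=> /skewE b; rewrite /pf; split=> i j k l.
- by rewrite (b i j); ring.
- by rewrite (b j k); ring.
- by rewrite (b k l); ring.
Qed.

(** The dual 2-form with respect to the coordinate volume, which makes Pfaffian
    identities available as matrix identities. *)
Definition dual (B : 'M[A]_4) : 'M[A]_4 := \matrix_(i, j)
  nth 0 (nth [::] [:: [:: 0; B o2 o3; - B o1 o3; B o1 o2];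
                      [:: - B o2 o3; 0; B o0 o3; - B o0 o2];
                      [:: B o1 o3; - B o0 o3; 0; B o0 o1];
                      [:: - B o1 o2; B o0 o2; - B o0 o1; 0]] i) j.

Lemma skew_norm (B : 'M[A]_4) : B^T = - B ->
  ((B o1 o0 = - B o0 o1) * (B o2 o0 = - B o0 o2) * (B o3 o0 = - B o0 o3)
  * (B o2 o1 = - B o1 o2) * (B o3 o1 = - B o1 o3) * (B o3 o2 = - B o2 o3)
  * (B o0 o0 = 0) * (B o1 o1 = 0) * (B o2 o2 = 0) * (B o3 o3 = 0))%type.
Proof.
move=> /skewE b; have b0 i : B i i = 0.
  by apply: (addrr_eq0 c2); rewrite {1}b addNr.
do !split; solve [exact: b | exact: b0].
Qed.

Lemma dualI B : B^T = - B -> dual (dual B) = B.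
Proof.
move=> /skew_norm b; apply/matrixP.
by do 2!elim/ord4_ind; rewrite !mxE /= ?b ?opprK.
Qed.

Lemma dualZ c B : dual (c *: B) = c *: dual B.
Proof.
apply/matrixP.
by do 2!elim/ord4_ind; rewrite !mxE /= ?(mulr0, mulrN).
Qed.

Lemma dualK B : B^T = - B -> B *m dual B = - (pf B o0 o1 o2 o3)%:M.
Proof.
move=> /skew_norm b; apply/matrixP.
by do 2!elim/ord4_ind; rewrite mxN mulE sum4 !mxE /= /pf !b; ring.
Qed.

Lemma tr_dual B C : B^T = - B -> C^T = - C ->
  \tr (B *m dual C) = - (wedge22 B C o0 o1 o2 o3 + wedge22 B C o0 o1 o2 o3).
Proof.
move=> /skew_norm b _; rewrite /mxtrace sum4 !mulE !sum4 !mxE /= !b /wedge22.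
by ring.
Qed.

(** For B the fundamental form this computes the norm of C from the component of
    C along B and from C /\ C. *)
Lemma tr_dual2 B C : B^T = - B -> C^T = - C ->
  \tr (dual B *m C *m (dual B *m C)) = 2%:R *
    (wedge22 B C o0 o1 o2 o3 ^+ 2
     - 2%:R * pf B o0 o1 o2 o3 * pf C o0 o1 o2 o3).
Proof.
move=> /skew_norm b /skew_norm d.
rewrite /mxtrace sum4 !mulE !sum4 !mulE !sum4 !mxE /= !d /wedge22 /pf.
by ring.
Qed.

Lemma contract22 (Z : 'I_4 -> A) B C a b c :
  \sum_d Z d * wedge22 B C d a b c
  = wedge12 (fun i => \sum_d Z d * B d i) C a b c
  + wedge12 (fun i => \sum_d Z d * C d i) B a b c.
Proof. by rewrite /wedge12 /wedge22 !sum4; ring. Qed.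

Lemma contract12 (Z : 'I_4 -> A) e (C : 'M[A]_4) b c :
  \sum_d Z d * wedge12 e C d b c
  = (\sum_d Z d * e d) * C b c
    - (e b * (\sum_d Z d * C d c) - e c * (\sum_d Z d * C d b)).
Proof. by rewrite /wedge12 !sum4; ring. Qed.

(** The Leibniz rule d(e /\ C) = de /\ C for a closed 2-form C. *)
Lemma der_wedge12 (D : derivations A) (e : 'I_4 -> A) (C : 'M[A]_4) j a b c :
  C^T = - C ->
  (forall i j k, D k (C i j) + D i (C j k) + D j (C k i) = 0) ->
  D j (wedge12 e C a b c) - D a (wedge12 e C j b c)
  + D b (wedge12 e C j a c) - D c (wedge12 e C j a b)
  = wedge22 (\matrix_(i, j) (D i (e j) - D j (e i))) C j a b c.
Proof.
move=> /skewE s cl; rewrite /wedge12 /wedge22 !(derD, derB, derN, derM) !mxE.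
have h x y z : D y (C z x) = - D y (C x z) by rewrite s derN.
have e1 := cl a b c; have e2 := cl j b c; have e3 := cl j a c.
have e4 := cl j a b.
rewrite (h a b c) in e1; rewrite (h j b c) in e2; rewrite (h j a c) in e3.
rewrite (h j a b) in e4.
apply: (lc2 (congr2 +%R (congr1 (fun x => - (e j * x)) e1)
                        (congr1 (fun x => e a * x) e2))
            (congr2 +%R (congr1 (fun x => - (e b * x)) e3)
                        (congr1 (fun x => e c * x) e4))).
by ring.
Qed.

(** The contraction of the 5-form B /\ e /\ C with V, which vanishes in
    dimension four. *)
Lemma contract_5form (V e : 'I_4 -> A) (B C : 'M[A]_4) :
  B^T = - B -> C^T = - C ->
  let iB i := \sum_d V d * B d i in let iC i := \sum_d V d * C d i in
  let w13 u M := u o0 * wedge12 e M o1 o2 o3 - u o1 * wedge12 e M o0 o2 o3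
    + u o2 * wedge12 e M o0 o1 o3 - u o3 * wedge12 e M o0 o1 o2 in
  w13 iB C + w13 iC B = - ((\sum_d V d * e d) * wedge22 B C o0 o1 o2 o3).
Proof.
move=> /skew_norm b /skew_norm d /=; rewrite /wedge12 /wedge22 !sum4 !(b, d).
by ring.
Qed.

End Forms.

(** * The closed forms attached to a Killing field *)

Section KahlerForms.
Variables (A : comNzRingType) (D : derivations A) (X : kahler_data D).
Local Notation g := (met X).
Local Notation G := (imet X).
Local Notation J := (cpx X).
Local Notation V := (vec X).
Local Notation Om := (fund X).
Local Notation Gam := (christ D g G).
Local Notation Rc := (ric D Gam).
Local Notation K := (cov_vec X).
Local Notation h := (lap X).
Local Notation rho := (rho X).
Local Notation vol := (pf Om).

Definition vflat j : A := \sum_k V k * g k j.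
Definition tau : 'M[A]_4 :=
  \matrix_(i, j) (D i (vflat j) - D j (vflat i)).
Definition nrm2 : A := \sum_j V j * vflat j.
Definition zeta j : A := - \sum_k V k * Om k j.
Definition gradz i : A := \sum_j G i j * zeta j.

(** The metric is parallel. *)
Lemma der_vflat i j :
  D i (vflat j) = (g *m K) j i + \sum_m Gam i m j * vflat m.
Proof.
rewrite /vflat der_sum; under eq_bigr do rewrite derM -DmE met_parallel mxD.
have -> : (g *m K) j i = \sum_k D i (V k) * g k j
    + \sum_k V k * ((Gam i)^T *m g) k j.
  rewrite mulE; under eq_bigr do rewrite cov_vecE mulrDr mulr_sumr.
  rewrite big_split exchange_big /=; congr (_ + _).
    by apply: eq_bigr => k _; rewrite gE mulrC.
  apply: eq_bigr => k _; rewrite mulE mulr_sumr; apply: eq_bigr => m _.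
  by rewrite trE (gE _ m j); ring.
have -> : \sum_m Gam i m j * (\sum_k V k * g k m)
    = \sum_k V k * (g *m Gam i) k j.
  under eq_bigr do rewrite mulr_sumr.
  rewrite exchange_big; apply: eq_bigr => k _ /=.
  by rewrite mulE mulr_sumr; apply: eq_bigr => m _; ring.
by rewrite -!big_split; apply: eq_bigr => k _ /=; ring.
Qed.

(** The Christoffel symbols are symmetric and nabla V is skew. *)
Lemma tauE : tau = - (g *m K + g *m K).
Proof.
apply/matrixP => i j; rewrite mxE !der_vflat mxN mxD.
have -> : \sum_m Gam i m j * vflat m = \sum_m Gam j m i * vflat m.
  by apply: eq_bigr => m _; rewrite christ_sym.
by rewrite (skewE (cov_skew X) i j); ring.
Qed.

Lemma tau_skew : tau^T = - tau.
Proof. by rewrite tauE trN trD cov_skew; mxring. Qed.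

Lemma tau_closed i j k : D k (tau i j) + D i (tau j k) + D j (tau k i) = 0.
Proof.
rewrite !mxE !derB (derC D k j) (derC D k i) (derC D j i); ring.
Qed.

Lemma tau_11 : J^T *m tau *m J = tau.
Proof.
have e : J^T *m (g *m K) *m J = g *m K.
  by rewrite -!mmA cov_cpx !mmA cpx_orth.
by rewrite tauE mmNr mmNl mmDr mmDl e.
Qed.

(** |V|^2 is a moment map for [tau]. *)
Lemma der_nrm2 i : D i nrm2 = - \sum_m V m * tau m i.
Proof.
rewrite /nrm2 der_sum; under eq_bigr do rewrite derM der_vflat mulrDr.
rewrite !big_split /=.
have e1 : \sum_m V m * (g *m K) m i
    = \sum_m D i (V m) * vflat m + \sum_j V j * \sum_m Gam i m j * vflat m.
  have -> : \sum_m V m * (g *m K) m i = \sum_m K m i * vflat m.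
    rewrite /vflat; under eq_bigr do rewrite mulE mulr_sumr.
    rewrite exchange_big; apply: eq_bigr => k _ /=; rewrite mulr_sumr.
    by apply: eq_bigr => m _; ring.
  under eq_bigr do rewrite cov_vecE mulrDl mulr_suml.
  rewrite big_split exchange_big /=; congr (_ + _); apply: eq_bigr => k _.
  by rewrite mulr_sumr; apply: eq_bigr => m _; ring.
have -> : - \sum_m V m * tau m i
    = \sum_m V m * (g *m K) m i + \sum_m V m * (g *m K) m i.
  rewrite -big_split -sumrN; apply: eq_bigr => m _ /=.
  by rewrite tauE mxN mxD; ring.
by apply: (lc1 (esym e1)); ring.
Qed.

Lemma imet_cpx : G *m J^T = - (J *m G).
Proof.
rewrite -[G *m J^T]mulmx1 -(metK X) mmA -[G *m J^T *m g]mmA trJg mmNr mmNl.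
by rewrite [G *m (g *m J)]mmA imetK mul1mx.
Qed.

Lemma fund_inv : Om *m (J *m G) = 1%:M.
Proof.
by rewrite fundE mmNl mmA -[g *m J *m J]mmA cpx2 mmNr mulmx1 mmNl opprK metK.
Qed.

Lemma raise_fund : G *m Om *m G = - (J *m G).
Proof. by rewrite fundE mmNr mmNl mmA imetK mul1mx. Qed.

Let v := vol o0 o1 o2 o3.

Lemma dual_fund : dual Om = - (v *: (J *m G)).
Proof.
have f : (J *m G) *m Om = 1%:M by apply: mulmx1C; exact: fund_inv.
rewrite -[LHS]mul1mx -f -mmA (dualK (half2 D) (fund_skew X)) mmNr.
by rewrite mul_mx_scalar.
Qed.

Lemma cpx_imet_skew : (J *m G)^T = - (J *m G).
Proof. by rewrite trM imet_sym imet_cpx. Qed.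

(** The operator Lambda, adjoint to the product with omega. *)
Definition contr B : A := half D * \tr (G *m B *m J).

(** Four-forms are multiples of the volume form, and the factor is computed by
    [tr_dual]. *)
Lemma wedge_fund B i j k l : B^T = - B ->
  wedge22 B Om i j k l = contr B * vol i j k l.
Proof.
move=> s; have o := fund_skew X; have [f1 f2 f3] := pf_alt o.
move: i j k l; apply: (alt4_eq (half2 D)); first exact: wedge22_alt.
  split=> i j k l; rewrite ?(f1 i j) ?(f2 i j k) ?(f3 i j k l); ring.
apply: (lc_double (half2 D) (esym (congr1 -%R (tr_dual (half2 D) s o)))).
rewrite dual_fund mmNr trcN -scalemxAr mxtraceZ mmA.
have -> : \tr (B *m J *m G) = \tr (G *m B *m J).
  by rewrite mxtrace_mulC -!mmA.
by rewrite /contr -/v -[X in v * X]mul1r -(half2 D); ring.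
Qed.

Lemma contr_tau : contr tau = h.
Proof.
rewrite /contr tauE mmNr mmNl mmDr mmDl !mmA imetK mul1mx trcN trcD.
rewrite /lap (cov_cpx X) -[X in _ = - X]mul1r -(half2 D); ring.
Qed.

(** Lambda rho is a multiple of the scalar curvature. *)
Lemma contr_rho : contr rho = 0.
Proof.
rewrite /contr rhoE mmNr mmNl mmDr mmDl trcN trcD.
have -> : \tr (G *m (J^T *m Rc) *m J) = 0.
  rewrite -[J^T *m Rc]opprK -ric_cpx mmNr mmNl -!mmA cpx2 !mmNr opprK mulmx1.
  rewrite -[RHS](scal0 X) /mxtrace; apply: eq_bigr => i _; rewrite mulE.
  by apply: eq_bigr => j _; rewrite -(trE Rc) ric_sym.
ring.
Qed.

Lemma wedge_tau i j k l : wedge22 tau Om i j k l = h * vol i j k l.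
Proof. by rewrite (wedge_fund _ _ _ _ tau_skew) contr_tau. Qed.

Lemma wedge_rho i j k l : wedge22 rho Om i j k l = 0.
Proof. by rewrite (wedge_fund _ _ _ _ (rho_skew X)) contr_rho mul0r. Qed.

Definition ric_norm : A := \tr (G *m Rc *m (G *m Rc)).

Lemma dual_inv : dual (J *m G) = - (pf (J *m G) o0 o1 o2 o3 *: Om).
Proof.
rewrite -[LHS]mul1mx -fund_inv -mmA (dualK (half2 D) cpx_imet_skew) mmNr.
by rewrite mul_mx_scalar.
Qed.

Lemma vol_unit : v * pf (J *m G) o0 o1 o2 o3 = 1.
Proof.
have dd := dualI (half2 D) (fund_skew X).
have e : Om = (v * pf (J *m G) o0 o1 o2 o3) *: Om.
  by rewrite -{1}dd dual_fund -scaleNr dualZ dual_inv scalerN -scaleNr opprK scalerA.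
have := congr1 (fun M => (M *m (J *m G)) o0 o0) e.
by rewrite -scalemxAl fund_inv !mxE mulr1.
Qed.

(** A (1,1)-form whose product with omega vanishes is anti-self-dual, so that
    rho /\ rho is minus the squared norm of rho times the volume. *)
Lemma wedge_rho_rho :
  - wedge22 rho rho o0 o1 o2 o3 = ric_norm * v + ric_norm * v.
Proof.
have := tr_dual2 (half2 D) (fund_skew X) (rho_skew X).
rewrite (wedge22C Om rho) wedge_rho dual_fund -/v => e.
have Wrho : J *m G *m rho = - (G *m Rc + G *m Rc).
  have JGJ : J *m G *m J^T = G by rewrite -mmA imet_cpx mmNr mmA cpx2 mmNl
    mul1mx opprK.
  by rewrite rhoE mmNr mmDr !mmA JGJ.
have t : \tr ((- (v *: (J *m G))) *m rho *m ((- (v *: (J *m G))) *m rho))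
   = v * v * (4%:R * ric_norm).
  rewrite !mmNl !mmNr opprK -!scalemxAl -!scalemxAr scalerA mxtraceZ Wrho.
  rewrite !mmNl !mmNr opprK !mmDl !mmDr !trcD /ric_norm; congr (_ * _).
  by ring.
(* [e] reads v^2 * 4 * ric_norm = - 4 * v * pf(rho); divide it by v *)
rewrite t expr0n /= in e; rewrite wedge22xx.
set p := pf (J *m G) o0 o1 o2 o3; set r := pf rho _ _ _ _ in e *.
have vp : v * p = 1 := vol_unit.
have q : v * (4%:R * ric_norm) = - (4%:R * r).
  have -> : v * (4%:R * ric_norm) = p * (v * v * (4%:R * ric_norm)).
    transitivity (v * p * (v * (4%:R * ric_norm))); last by ring.
    by rewrite vp mul1r.
  rewrite e; transitivity (- (4%:R * (v * p * r))); first by ring.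
  by rewrite vp; ring.
by apply: (lc_double (half2 D) (esym q)); ring.
Qed.

(** * The primitive and its differential *)

Section Primitive.
Variable w : A.
Hypothesis w_inv : w * nrm2 = 1.

Lemma der_winv i : D i w = w * w * \sum_m V m * tau m i.
Proof.
have e : D i w * nrm2 + w * D i nrm2 = 0 by rewrite -derM w_inv der1.
rewrite -[LHS]mulr1 -w_inv mulrCA.
have -> : D i w * nrm2 = w * \sum_m V m * tau m i.
  by apply: (lc1 e); rewrite der_nrm2; ring.
by rewrite mulrA.
Qed.

Lemma gradzE d : gradz d = - \sum_m J d m * V m.
Proof.
have -> : gradz d = \sum_k V k * (G *m Om) d k.
  rewrite /gradz; under eq_bigr do rewrite /zeta mulrN mulr_sumr.
  rewrite sumrN exchange_big -sumrN; apply: eq_bigr => k _ /=.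
  rewrite mulE mulr_sumr -sumrN; apply: eq_bigr => j _.
  by rewrite (skewE (fund_skew X) j k); ring.
rewrite fundE mmNr mmA imetK mul1mx -sumrN; apply: eq_bigr => k _.
by rewrite mxN; ring.
Qed.

(** Contracting omega with Z = - JV gives V_flat. *)
Lemma gradz_fund a : \sum_d gradz d * Om d a = vflat a.
Proof.
have -> : \sum_d gradz d * Om d a = - \sum_m V m * (J^T *m Om) m a.
  under eq_bigr do rewrite gradzE mulNr mulr_suml.
  rewrite sumrN exchange_big; congr (- _); apply: eq_bigr => m _ /=.
  by rewrite mulE mulr_sumr; apply: eq_bigr => d _; rewrite trE; ring.
rewrite fundE mmNr mmA trJg mmNl -mmA cpx2 mmNr mulmx1 !opprK -sumrN.
by apply: eq_bigr => m _; rewrite mxN; ring.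
Qed.

(** When df = - i_V B with B of type (1,1), this says that J df = - i_Z B. *)
Lemma cpx_contract (B : 'M[A]_4) i : J^T *m B *m J = B ->
  \sum_k (\sum_m V m * B m k) * J k i = \sum_d gradz d * B d i.
Proof.
move=> inv; have e : B *m J = - (J^T *m B).
  have : J^T *m (J^T *m B *m J) = J^T *m B by rewrite inv.
  by rewrite !mmA -trM cpx2 trN trmx1 mmNl mmNl mul1mx => <-; rewrite opprK.
have -> : \sum_k (\sum_m V m * B m k) * J k i = \sum_m V m * (B *m J) m i.
  under eq_bigr do rewrite mulr_suml.
  rewrite exchange_big; apply: eq_bigr => m _ /=.
  by rewrite mulE mulr_sumr; apply: eq_bigr => k _; ring.
under [RHS]eq_bigr do rewrite gradzE mulNr mulr_suml.
rewrite sumrN exchange_big -sumrN; apply: eq_bigr => m _ /=.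
rewrite e mxN mulrN mulE mulr_sumr; congr (- _); apply: eq_bigr => d _.
by rewrite trE; ring.
Qed.

Lemma skew_contract0 (Z : 'I_4 -> A) (B : 'M[A]_4) : B^T = - B ->
  \sum_i Z i * \sum_j Z j * B j i = 0.
Proof.
by move=> /(skew_norm (half2 D)) b; rewrite !sum4 !b; ring.
Qed.

Lemma gradz_vflat0 : \sum_d gradz d * vflat d = 0.
Proof.
rewrite -[RHS](skew_contract0 gradz (fund_skew X)).
by apply: eq_bigr => d _; rewrite gradz_fund.
Qed.

(** The form V_flat /\ omega, which is the contraction of the volume form with
    Z. *)
Definition mu := wedge12 vflat Om.

Lemma contract_vol a b c : \sum_d gradz d * vol d a b c = mu a b c.
Proof.
have e : \sum_d gradz d * wedge22 Om Om d a b c = mu a b c + mu a b c.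
  rewrite contract22 /mu; congr (_ + _); rewrite /wedge12 !gradz_fund //.
apply: (lc_double (half2 D) e); under [X in _ = X - _]eq_bigr do
  rewrite wedge22xx mulrDr.
by rewrite big_split /=; ring.
Qed.

Lemma gradz_mu0 b c : \sum_d gradz d * mu d b c = 0.
Proof. by rewrite contract12 gradz_vflat0 !gradz_fund; ring. Qed.

(** The function (h / |V|)^2. *)
Definition ratio2 := h * h * w.

(** The form J dF, for F the function [ratio2]. *)
Definition dcF i := \sum_k D k ratio2 * J k i.

Lemma dcFE i : dcF i = - (2%:R * h * w) * (\sum_d gradz d * rho d i)
   + h * h * w * w * (\sum_d gradz d * tau d i).
Proof.
rewrite -(cpx_contract i (rho_11 X)) -(cpx_contract i tau_11) /dcF.
rewrite !mulr_sumr -big_split; apply: eq_bigr => k _ /=.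
by rewrite /ratio2 !derM der_lap der_winv; ring.
Qed.

Lemma dcF_gradz : \sum_d dcF d * gradz d = 0.
Proof.
under eq_bigr do rewrite dcFE mulrC mulrDr !(mulrCA (gradz _)).
rewrite big_split /= -!mulr_sumr (skew_contract0 _ (rho_skew X)).
by rewrite (skew_contract0 _ tau_skew) !mulr0 addr0.
Qed.

Lemma dcF_vec : \sum_i V i * dcF i = - \sum_k gradz k * D k ratio2.
Proof.
rewrite /dcF; under eq_bigr do rewrite mulr_sumr.
rewrite exchange_big -sumrN; apply: eq_bigr => k _ /=.
rewrite gradzE mulNr opprK mulr_suml; apply: eq_bigr => i _; ring.
Qed.

Lemma contr_vflat e : contr (wedge11 e vflat) = \sum_d e d * gradz d.
Proof.
have c : \sum_i \sum_j e i * vflat j * (J *m G) j i = \sum_d e d * gradz d.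
  apply: eq_bigr => i _; under eq_bigr do rewrite -mulrA.
  rewrite -mulr_sumr; congr (_ * _).
  have -> : \sum_j vflat j * (J *m G) j i
      = \sum_k V k * (g *m (J *m G)) k i.
    under eq_bigr do rewrite /vflat mulr_suml.
    rewrite exchange_big; apply: eq_bigr => k _ /=.
    by rewrite mulE mulr_sumr; apply: eq_bigr => j _; ring.
  rewrite mmA -[g *m J]opprK -trJg mmNl -mmA metK mulmx1 gradzE -sumrN.
  by apply: eq_bigr => k _; rewrite mxN trE; ring.
have t : \tr (wedge11 e vflat *m (J *m G))
    = \sum_d e d * gradz d + \sum_d e d * gradz d.
  rewrite -c [X in _ = _ + X]exchange_big -big_split; apply: eq_bigr => i _ /=.
  rewrite mulE -big_split; apply: eq_bigr => j _ /=.
  by rewrite wedge11E (skewE cpx_imet_skew i j); ring.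
rewrite /contr -mmA mxtrace_mulC -mmA t.
by rewrite -[RHS]mul1r -(half2 D); ring.
Qed.

Let zv := wedge11 zeta vflat.

(** The form J dF /\ V_flat /\ omega vanishes, as Lambda of J dF /\ V_flat is
    dF applied to JZ = V; contract it with V. *)
Lemma dcF_wedge a b c : wedge12 dcF Om a b c
  = - (w * (\sum_k gradz k * D k ratio2)) * mu a b c + w * wedge12 dcF zv a b c.
Proof.
set B := wedge11 dcF vflat.
have sB : B^T = - B by apply/matrixP => i j; rewrite trE mxN !wedge11E; ring.
have : \sum_d V d * wedge22 B Om d a b c = 0.
  rewrite big1 // => d _; rewrite (wedge_fund _ _ _ _ sB) contr_vflat.
  by rewrite dcF_gradz mul0r mulr0.
rewrite contract22 => e.
have iB i : \sum_d V d * B d i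
    = - (\sum_k gradz k * D k ratio2) * vflat i - nrm2 * dcF i.
  rewrite -dcF_vec /nrm2 !mulr_suml -sumrB; apply: eq_bigr => d _.
  by rewrite wedge11E; ring.
have iO i : \sum_d V d * Om d i = - zeta i by rewrite opprK.
have e' : wedge12 (fun i => - (\sum_k gradz k * D k ratio2) * vflat i
    - nrm2 * dcF i) Om a b c + wedge12 (fun i => - zeta i) B a b c = 0.
  by rewrite -[RHS]e /wedge12 !iB !iO.
have e2 : nrm2 * wedge12 dcF Om a b c
   = - (\sum_k gradz k * D k ratio2) * mu a b c + wedge12 dcF zv a b c.
  apply: (lc1 (esym e')); rewrite /mu /wedge12 /zv !wedge11E; ring.
by rewrite -[LHS]mul1r -w_inv -mulrA e2; ring.
Qed.

(** The form F V_flat /\ dVol2, and its Lie derivative along the field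
    Z / |V|^2 of which [w * gradz j] is the component j. *)
Definition gam a b c := ratio2 * wedge12 vflat (Om - w *: zv) a b c.

Lemma gamE a b c : gam a b c = ratio2 * mu a b c.
Proof.
rewrite /gam /mu /wedge12 /zv; congr (_ * _).
have e i j : (Om - w *: wedge11 zeta vflat) i j
   = Om i j - w * (zeta i * vflat j - zeta j * vflat i).
  by rewrite mxD mxN mxZ wedge11E.
by rewrite !e; ring.
Qed.

Definition lie_gam a b c :=
  \sum_j w * gradz j * D j (gam a b c)
  + (\sum_j D a (w * gradz j) * gam j b c
     + \sum_j D b (w * gradz j) * gam a j c
     + \sum_j D c (w * gradz j) * gam a b j).

(** Cartan's formula: the field Z / |V|^2 contracts [gam] to zero, so that the
    Lie derivative is the contraction of
    d(F V_flat /\ omega) = dF /\ V_flat /\ omega + F h vol. *)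
Lemma lie_gamE a b c :
  lie_gam a b c = w * (\sum_k gradz k * D k ratio2 + ratio2 * h) * mu a b c.
Proof.
have x0 y z : \sum_j w * gradz j * gam j y z = 0.
  under eq_bigr do rewrite gamE mulrACA.
  by rewrite -mulr_sumr gradz_mu0 mulr0.
have dx x y z : \sum_j D x (w * gradz j) * gam j y z
    = - \sum_j w * gradz j * D x (gam j y z).
  have := congr1 (D x) (x0 y z); rewrite der0 der_sum.
  under eq_bigr do rewrite derM; rewrite big_split /= => e.
  by apply: (lc1 e); ring.
have s1 i j k : gam i j k = - gam j i k.
  rewrite !gamE /mu /wedge12 (skewE (fund_skew X) i j); ring.
have s2 i j k : gam i j k = gam k i j.
  rewrite !gamE /mu /wedge12 (skewE (fund_skew X) i k).
  by rewrite (skewE (fund_skew X) j k); ring.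
have Ea : \sum_j D b (w * gradz j) * gam a j c
    = \sum_j w * gradz j * D b (gam j a c).
  rewrite -[RHS]opprK -dx -sumrN; apply: eq_bigr => j _.
  by rewrite (s1 a j c) mulrN.
have Eb : \sum_j D c (w * gradz j) * gam a b j
    = - \sum_j w * gradz j * D c (gam j a b).
  by rewrite -dx; apply: eq_bigr => j _; rewrite (s2 a b j).
rewrite /lie_gam dx Ea Eb.
have -> : \sum_j w * gradz j * D j (gam a b c) +
  (- (\sum_j w * gradz j * D a (gam j b c)) +
   \sum_j w * gradz j * D b (gam j a c) -
   \sum_j w * gradz j * D c (gam j a b))
  = \sum_j (w * gradz j * D j ratio2 * mu a b c
     - w * D a ratio2 * (gradz j * mu j b c) + w * D b ratio2 * (gradz j * mu j a c)
     - w * D c ratio2 * (gradz j * mu j a b) + w * ratio2 * h * (gradz j * vol j a b c)).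
  rewrite -!sumrN -!big_split; apply: eq_bigr => j _ /=.
  have cl x y z : D z (Om x y) + D x (Om y z) + D y (Om z x) = 0.
    by rewrite -[RHS](fund_closed X z x y).
  have d := der_wedge12 vflat j a b c (fund_skew X) cl.
  rewrite -/tau wedge_tau in d.
  rewrite !gamE !derM.
  by apply: (lc1 (congr1 (fun x => w * gradz j * ratio2 * x) d)); rewrite /mu; ring.
rewrite !(sumrB, big_split) /= -!mulr_sumr !gradz_mu0 contract_vol -mulr_suml.
have -> : \sum_j w * gradz j * D j ratio2 = w * \sum_k gradz k * D k ratio2.
  by rewrite mulr_sumr; apply: eq_bigr => j _; rewrite mulrA.
ring.
Qed.

(** The localisation form: V_flat /\ [prim2] is the degree 3 part of
    theta (rho + h)^2 / (dtheta + N), up to sign, where theta = V_flat and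
    N = |V|^2; it is the equivariant primitive of (rho + h)^2. *)
Definition prim2 := (- (2%:R * h * w)) *: rho + (h * h * w * w) *: tau.

(** By [dcF_wedge] the left-hand side is F h / |V|^2 V_flat /\ omega minus
    J dF /\ omega, and J dF is a combination of i_Z rho and i_Z tau. Contracting
    rho /\ omega = 0 and tau /\ omega = h vol with Z gives the result. *)
Lemma primitiveE a b c :
  lie_gam a b c - wedge12 dcF (w *: zv) a b c = wedge12 vflat prim2 a b c.
Proof.
have -> : wedge12 dcF (w *: zv) a b c = w * wedge12 dcF zv a b c.
  by rewrite /wedge12 !mxZ; ring.
rewrite lie_gamE.
have := contract22 gradz rho Om a b c.
rewrite big1 => [e1|d _]; last by rewrite wedge_rho mulr0.
have := contract22 gradz tau Om a b c.
under eq_bigr do rewrite wedge_tau mulrCA.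
rewrite -mulr_sumr contract_vol => e2.
have f B : wedge12 (fun i => \sum_d gradz d * Om d i) B a b c
    = wedge12 vflat B a b c by rewrite /wedge12 !gradz_fund.
rewrite !f in e1 e2.
have e3 := dcF_wedge a b c.
have e4 : wedge12 dcF Om a b c = - (2%:R * h * w) *
    wedge12 (fun i => \sum_d gradz d * rho d i) Om a b c
    + h * h * w * w * wedge12 (fun i => \sum_d gradz d * tau d i) Om a b c.
  by rewrite /wedge12 !dcFE; ring.
have -> : wedge12 vflat prim2 a b c = - (2%:R * h * w) * wedge12 vflat rho a b c
   + (h * h * w * w) * wedge12 vflat tau a b c.
  by rewrite /wedge12 !mxD !mxZ; ring.
rewrite e4 in e3.
apply: (lc2 e3 (congr2 +%R
   (congr1 (fun x => - (2%:R * h * w) * x) e1)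
   (congr1 (fun x => h * h * w * w * x) e2))).
by rewrite /ratio2; ring.
Qed.

(** The differentials of the coefficients are combinations of i_V rho and
    i_V tau. By [contract_5form] their products with V_flat /\ rho and
    V_flat /\ tau cancel the terms in tau /\ rho and tau /\ tau, and leave
    - rho /\ rho. *)
Lemma der_primitive :
  D o0 (wedge12 vflat prim2 o1 o2 o3) - D o1 (wedge12 vflat prim2 o0 o2 o3)
  + D o2 (wedge12 vflat prim2 o0 o1 o3) - D o3 (wedge12 vflat prim2 o0 o1 o2)
  = ric_norm * v + ric_norm * v.
Proof.
rewrite -wedge_rho_rho.
pose c1 := - (2%:R * h * w); pose c2 := h * h * w * w.
have HQ a b c : wedge12 vflat prim2 a b c
   = c1 * wedge12 vflat rho a b c + c2 * wedge12 vflat tau a b c.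
  by rewrite /wedge12 !mxD !mxZ -/c1 -/c2; ring.
pose ir i := \sum_d V d * rho d i; pose it i := \sum_d V d * tau d i.
have dc1 i : D i c1 = 2%:R * w * ir i - 2%:R * h * w * w * it i.
  rewrite /c1 derN !derM der_lap der_winv -/(ir i) -/(it i).
  have -> : D i 2%:R = 0 by rewrite mulr2n derD der1 addr0.
  by ring.
have dc2 i : D i c2 = - (2%:R * h * w * w) * ir i
    + 2%:R * h * h * w * w * w * it i.
  by rewrite /c2 !derM der_lap der_winv -/(ir i) -/(it i); ring.
have dr := der_wedge12 vflat o0 o1 o2 o3 (rho_skew X) (rho_closed X).
have dt := der_wedge12 vflat o0 o1 o2 o3 tau_skew tau_closed.
rewrite -/tau in dr dt.
have krr := contract_5form (half2 D) V vflat (rho_skew X) (rho_skew X).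
have ktr := contract_5form (half2 D) V vflat tau_skew (rho_skew X).
have ktt := contract_5form (half2 D) V vflat tau_skew tau_skew.
rewrite /= -!/(ir _) -!/(it _) -/nrm2 in krr ktr ktt.
have nw y z : y = - (nrm2 * z) -> w * y = - z.
  by move=> ->; rewrite mulrN mulrA w_inv mul1r.
rewrite !HQ !derD !(derM D _ c1) !(derM D _ c2) !dc1 !dc2.
apply: (lc2
  (congr2 +%R (congr1 (fun x => c1 * x) dr) (congr1 (fun x => c2 * x) dt))
  (congr2 +%R (nw _ _ krr)
    (congr2 +%R (congr1 (fun x => - (2%:R * h * w) * x) (nw _ _ ktr))
       (congr1 (fun x => h * h * w * w * x) (nw _ _ ktt))))).
by rewrite /c1 /c2; ring.
Qed.

End Primitive.
End KahlerForms.

(** * Hodge star and Laplacian *)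

Section Hodge.
Variables (A : comNzRingType) (D : derivations A) (X : kahler_data D).
Local Notation g := (met X).
Local Notation G := (imet X).
Local Notation J := (cpx X).
Local Notation V := (vec X).
Local Notation Om := (fund X).
Local Notation Gam := (christ D g G).
Local Notation K := (cov_vec X).
Local Notation h := (lap X).
Local Notation vol := (pf Om).
Local Notation zeta := (zeta X).
Local Notation vflat := (vflat X).

(** The Hessian of the potential is the covariant derivative of [zeta], and omega
    is parallel. *)
Lemma lap_hess :
  \sum_i \sum_j G i j * (D i (zeta j) - \sum_k Gam i k j * zeta k) = h.
Proof.
have pOm i : Dm D i Om = (Gam i)^T *m Om + Om *m Gam i.
  by rewrite fundE DmN DmM met_parallel cpx_parallel; mxring.
have e i j : D i (zeta j) - \sum_k Gam i k j * zeta k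
    = - (K^T *m Om) i j.
  rewrite /zeta derN der_sum.
  under eq_bigr do rewrite derM -DmE pOm mxD.
  have -> : (K^T *m Om) i j = \sum_k D i (V k) * Om k j
      + \sum_k V k * ((Gam i)^T *m Om) k j.
    rewrite mulE; under eq_bigr do rewrite trE cov_vecE mulrDl mulr_suml.
    rewrite big_split exchange_big /=; congr (_ + _); apply: eq_bigr => k _.
    by rewrite mulE mulr_sumr; apply: eq_bigr => m _; rewrite trE; ring.
  have -> : \sum_k Gam i k j * - (\sum_m V m * Om m k)
      = - \sum_k V k * (Om *m Gam i) k j.
    under eq_bigr do rewrite mulrN mulr_sumr.
    rewrite sumrN exchange_big; congr (- _); apply: eq_bigr => m _ /=.
    by rewrite mulE mulr_sumr; apply: eq_bigr => k _; ring.
  rewrite opprK -big_split -!sumrN -big_split; apply: eq_bigr => k _ /=.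
  by ring.
under eq_bigr do under eq_bigr do rewrite e mulrN.
have -> : \sum_i \sum_j - (G i j * (K^T *m Om) i j)
    = - \tr (K^T *m Om *m G).
  rewrite -sumrN; apply: eq_bigr => i _; rewrite mulE -sumrN.
  by apply: eq_bigr => j _; rewrite -{1}(imet_sym X) trE mulrC.
rewrite -mxtrace_tr 2!trM imet_sym fund_skew trmxK mmNl mmNr trcN opprK mmA.
by rewrite fundE mmNr mmA imetK mul1mx mmNl trcN.
Qed.

Lemma imet_fund : G *m Om = - J.
Proof. by rewrite fundE mmNr mmA imetK mul1mx. Qed.

Lemma contr_sum B :
  half D * \sum_i \sum_j (G *m B *m G) i j * Om i j = contr X B.
Proof.
rewrite /contr -[J]opprK -imet_fund mmNr trcN -sumrN mmA; congr (_ * _).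
apply: eq_bigr => i _; rewrite mulE -sumrN; apply: eq_bigr => j _.
by rewrite (skewE (fund_skew X) i j) mulrN opprK.
Qed.

Lemma pull_wedge11 (M : 'M[A]_4) e f : M^T *m wedge11 e f *m M
  = wedge11 (fun i => \sum_k e k * M k i) (fun i => \sum_k f k * M k i).
Proof.
apply/matrixP => i j; rewrite mulE wedge11E !sum4 !mulE !sum4 !trE !wedge11E.
by ring.
Qed.

(** For a (1,1)-form B this is * B = (Lambda B) omega - B. *)
Lemma hodge_11 B k l : B^T = - B -> J^T *m B *m J = B ->
  half D * \sum_i \sum_j (G *m B *m G) i j * vol i j k l
  = contr X B * Om k l - B k l.
Proof.
move=> sB iB; set M := G *m B *m G.
have sM : M^T = - M by rewrite !trM sB imet_sym mmNl mmNr mmA.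
have e : Om^T *m M *m Om = B.
  rewrite /M !mmA -[Om^T *m G]trmxK trM trmxK imet_sym imet_fund.
  by rewrite -!mmA imet_fund !mmNr trN mmNl opprK mmA.
have E p q : \sum_i \sum_j M i j * (Om i p * Om j q) = B p q.
  rewrite -[in RHS]e mulE; under [RHS]eq_bigr do rewrite mulE mulr_suml.
  rewrite exchange_big; apply: eq_bigr => j _; apply: eq_bigr => i _ /=.
  by rewrite trE; ring.
rewrite -contr_sum -/M.
have -> : \sum_i \sum_j M i j * vol i j k l
   = (\sum_i \sum_j M i j * Om i j) * Om k l - (B k l - B l k).
  rewrite -!E mulr_suml -!sumrB; apply: eq_bigr => i _.
  rewrite mulr_suml -!sumrB; apply: eq_bigr => j _.
  by rewrite /pf; ring.
rewrite (skewE sB k l); transitivity (half D * (\sum_i \sum_j M i j * Om i j)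
  * Om k l - (half D + half D) * B k l); first by ring.
by rewrite half2 mul1r.
Qed.

(** The inner product of [tau] /\ omega = h vol with vol. *)
Lemma wedge_raise :
  wedge22 (G *m tau X *m G) (G *m Om *m G) o0 o1 o2 o3 * vol o0 o1 o2 o3 = h.
Proof.
have sT : (G *m tau X *m G)^T = - (G *m tau X *m G).
  by rewrite !trM tau_skew imet_sym mmNl mmNr mmA.
have sW : (- (J *m G))^T = - - (J *m G) by rewrite trN cpx_imet_skew.
rewrite raise_fund.
have t := tr_dual (half2 D) sT sW.
have dN : dual (- (J *m G)) = pf (J *m G) o0 o1 o2 o3 *: Om.
  by rewrite -scaleN1r dualZ dual_inv scalerN scaleN1r opprK.
rewrite dN -scalemxAr mxtraceZ -[_ *m G *m Om]mmA imet_fund mmNr trcN in t.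
have c := contr_tau X; rewrite /contr in c.
apply: (lc_double (half2 D) (congr1 (fun x => - x * vol o0 o1 o2 o3) (esym t))).
have vu := vol_unit X.
have e2 : \tr (G *m tau X *m J) = h + h.
  by rewrite -c -[LHS]mul1r -(half2 D); ring.
rewrite e2.
apply: (lc1 (congr1 (fun x => 2%:R * h * x) vu)); ring.
Qed.

Variable w : A.
Hypothesis w_inv : w * nrm2 X = 1.

(** Since Lambda omega = 2 and Lambda (zeta /\ V_flat) = |V|^2, the form dVol2
    has Lambda equal to 1. *)
Lemma hodge_vol2 k l :
  half D * \sum_i \sum_j
    (G *m (Om - w *: wedge11 zeta vflat) *m G) i j * vol i j k l
  = w * wedge11 zeta vflat k l.
Proof.
have sz : (wedge11 zeta vflat)^T = - wedge11 zeta vflat.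
  by apply/matrixP => i j; rewrite trE mxN !wedge11E; ring.
have zetaJ i : \sum_k zeta k * J k i = - vflat i.
  rewrite -(gradz_fund X i) -sumrN.
  have -> : \sum_d - (gradz X d * Om d i) = \sum_m V m * (J^T *m Om) m i.
    under eq_bigr do rewrite gradzE mulNr opprK mulr_suml.
    rewrite exchange_big; apply: eq_bigr => m _ /=.
    by rewrite mulE mulr_sumr; apply: eq_bigr => d _; rewrite trE; ring.
  have -> : J^T *m Om = - (Om *m J).
    by rewrite fundE mmNr mmNl opprK mmA trJg mmNl opprK.
  have -> : \sum_m V m * (- (Om *m J)) m i
      = - \sum_k (\sum_m V m * Om m k) * J k i.
    under [in RHS]eq_bigr do rewrite mulr_suml.
    rewrite exchange_big -sumrN; apply: eq_bigr => m _ /=.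
    rewrite mxN mulrN mulE mulr_sumr; congr (- _).
    by apply: eq_bigr => p _; ring.
  by rewrite -sumrN; apply: eq_bigr => p _; rewrite /zeta mulNr.
have vflatJ i : \sum_k vflat k * J k i = zeta i.
  rewrite /zeta /vflat; under eq_bigr do rewrite mulr_suml.
  rewrite exchange_big -sumrN; apply: eq_bigr => m _ /=.
  rewrite fundE mxN mulrN opprK mulE mulr_sumr.
  by apply: eq_bigr => p _; rewrite mulrA.
have iz : J^T *m wedge11 zeta vflat *m J = wedge11 zeta vflat.
  by rewrite pull_wedge11; apply/matrixP => i j; rewrite !wedge11E !zetaJ
    !vflatJ; ring.
have iO : J^T *m Om *m J = Om.
  by rewrite fundE mmNr mmNl mmA cpx_orth.
have sO := fund_skew X.
have sB : (Om - w *: wedge11 zeta vflat)^T = - (Om - w *: wedge11 zeta vflat).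
  by rewrite trD trN linearZ /= sz sO scalerN opprD.
have iB : J^T *m (Om - w *: wedge11 zeta vflat) *m J
    = Om - w *: wedge11 zeta vflat.
  by rewrite mmDr mmDl mmNr mmNl -scalemxAr -scalemxAl iz iO.
rewrite (hodge_11 _ _ sB iB).
have cO : contr X Om = 2%:R.
  rewrite /contr imet_fund mmNl cpx2 opprK mxtrace1.
  rewrite -[RHS]mul1r -(half2 D); ring.
have cz : contr X (wedge11 zeta vflat) = nrm2 X.
  rewrite contr_vflat /nrm2.
  have -> : \sum_d zeta d * gradz X d
      = \sum_k V k * \sum_d gradz X d * Om d k.
    under eq_bigr do rewrite /zeta mulNr mulr_suml.
    rewrite sumrN exchange_big -sumrN; apply: eq_bigr => p _ /=.
    rewrite mulr_sumr -sumrN; apply: eq_bigr => d _.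
    by rewrite (skewE sO d p); ring.
  by apply: eq_bigr => p _; rewrite gradz_fund.
have -> : contr X (Om - w *: wedge11 zeta vflat) = 1.
  have -> : contr X (Om - w *: wedge11 zeta vflat)
      = contr X Om - w * contr X (wedge11 zeta vflat).
    rewrite /contr mmDr mmDl mmNr mmNl -scalemxAr -scalemxAl trcD trcN mxtraceZ.
    by ring.
  by rewrite cO cz w_inv; ring.
by rewrite mxD mxN mxZ; ring.
Qed.
Lemma alt4_der (q : 'I_4 -> 'I_4 -> 'I_4 -> A) :
  (forall i j k, q j i k = - q i j k) -> (forall i j k, q i k j = - q i j k) ->
  alt4 (fun j a b c => D j (q a b c) - D a (q j b c) + D b (q j a c)
                       - D c (q j a b)).
Proof.
move=> q1 q2; split=> i j k l.
- by rewrite (q1 i j l) (q1 i j k) !derN; ring.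
- by rewrite (q2 i j k) (q1 j k l) !derN; ring.
- by rewrite (q2 i k l) (q2 j k l) !derN; ring.
Qed.

(** Both sides are alternating, so [der_primitive] suffices. *)
Lemma der_primitive_all j a b c :
  let q := wedge12 vflat (prim2 X w) in
  D j (q a b c) - D a (q j b c) + D b (q j a c) - D c (q j a b)
  = (ric_norm X + ric_norm X) * vol j a b c.
Proof.
move=> q; move: j a b c.
have sQ : (prim2 X w)^T = - prim2 X w.
  rewrite /prim2 trD !linearZ /=.
  have -> : (rho X)^T = - rho X by exact: rho_skew.
  by rewrite tau_skew !scalerN opprD.
have sk := skewE sQ.
apply: (alt4_eq (half2 D)).
- apply: alt4_der => i j k; rewrite /q /wedge12.
    by rewrite (sk i j); ring.
  by rewrite (sk j k); ring.
- have [f1 f2 f3] := pf_alt (fund_skew X).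
  split=> i j k l.
  + by rewrite (f1 i j); ring.
  + by rewrite (f2 i j k); ring.
  + by rewrite (f3 i j k l); ring.
by rewrite (der_primitive w_inv); ring.
Qed.

End Hodge.

(** * Symmetry of second derivatives *)

Section Schwarz.
Variables (R : realType) (V : normedModType R).
Implicit Types (f : V -> R) (x u v c : V).

Lemma is_derive_line f c u (s : R) : differentiable f (s *: u + c) ->
  is_derive s 1 (fun s => f (s *: u + c)) ('D_u f (s *: u + c)).
Proof.
move=> df.
have e : (fun h : R => h^-1 *: (f ((h *: 1 + s) *: u + c) - f (s *: u + c)))
    = (fun h => h^-1 *: (f (h *: u + (s *: u + c)) - f (s *: u + c))).
  by apply/funext => h; rewrite scalerDl -[h *: 1]/(h * 1) mulr1 addrA.
have d : derivable f (s *: u + c) u := diff_derivable df.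
by split; [rewrite /derivable e | rewrite /derive e].
Qed.

Lemma differentiable_bound f x (e : R) : differentiable f x -> 0 < e ->
  exists2 r : R, 0 < r &
    forall k, `|k| < r -> `|f (k + x) - f x - 'D_k f x| <= e * `|k|.
Proof.
move=> df e0; have /eqaddoP/(_ e e0) := diff_locally df.
rewrite nearE => /nbhs_ballP[r /= r0 hr]; exists r => // k kr.
have := hr k; rewrite -ball_normE /= sub0r normrN => /(_ kr).
by rewrite !fctE /= opprD addrA deriveE.
Qed.

(** The second difference is t times a derivative in the direction u at an
    intermediate point, by the mean value theorem; differentiability of this
    derivative at x is all that is used to evaluate it. *)
Lemma second_difference f x u v (e : R) :
  (\forall y \near x, differentiable f y) ->
  differentiable (fun y => 'D_u f y) x -> 0 < e ->
  exists2 r : R, 0 < r & forall t, 0 < t -> t < r ->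
    `|f (t *: u + (t *: v + x)) - f (t *: u + x) - f (t *: v + x) + f x
      - t * (t * 'D_v (fun y => 'D_u f y) x)|
    <= e * (`|u| + `|v| + `|u|) * (t * t).
Proof.
move=> df dh e0.
have [r1 r1_gt0 h1] := differentiable_bound dh e0.
have [r2 r2_gt0 h2] : exists2 r2 : R, 0 < r2 &
    forall k, `|k| < r2 -> differentiable f (k + x).
  move: df => /nbhs_ballP[r /= r0 hr]; exists r => // k kr.
  by apply: hr; rewrite -ball_normE /= opprD addrCA subrr addr0 normrN.
(* [t * m < Num.min r1 r2] keeps the points x + s u + s' v with s, s' in
   [0, t] within both radii. *)
pose m := `|u| + `|v| + 1.
have m_gt0 : 0 < m by rewrite ltr_pwDr // addr_ge0.
exists (Num.min r1 r2 / m) => [|t t0].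
  by rewrite divr_gt0 // lt_min r1_gt0.
rewrite ltr_pdivlMr // lt_min => /andP[tr1 tr2].
have small (s s' : R) : 0 <= s <= t -> 0 <= s' <= t ->
    `|s *: u + s' *: v| < Num.min r1 r2.
  move=> /andP[s0 st] /andP[s0' st']; apply: (@le_lt_trans _ _ (t * (m - 1))).
    rewrite /m addrK mulrDr (le_trans (ler_normD _ _)) // !normrZ.
    by rewrite !ger0_norm // lerD // ler_wpM2r.
  by rewrite lt_min !(le_lt_trans _ tr1, le_lt_trans _ tr2) //
    ler_wpM2l ?(ltW t0) // gerBl.
have tt : 0 <= t <= t by rewrite ltW //= lexx.
have t00 : 0 <= (0 : R) <= t by rewrite lexx ltW.
have small1 (s : R) : 0 <= s <= t -> `|s *: u| < Num.min r1 r2.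
  by move=> st; have := small s 0 st t00; rewrite scale0r addr0.
pose phi s : R := f (s *: u + (t *: v + x)) - f (s *: u + x).
pose dphi s : R := 'D_u f (s *: u + (t *: v + x)) - 'D_u f (s *: u + x).
have phiD (s : R) : 0 <= s <= t -> is_derive s 1 phi (dphi s).
  move=> st; apply: is_deriveB; apply: is_derive_line.
    rewrite addrA; apply: h2; apply: lt_le_trans (small _ _ st tt) _.
    by rewrite ge_min lexx orbT.
  apply: h2; apply: lt_le_trans (small1 _ st) _.
  by rewrite ge_min lexx orbT.
(* the mean value theorem for the increment of f along t v *)
have [xi] : exists2 c, c \in `]0, t[%R & phi t - phi 0 = dphi c * (t - 0).
  apply: MVT => // [s|].
    by rewrite in_itv /= => /andP[s0 st]; apply: phiD; rewrite !ltW.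
  apply: derivable_within_continuous => s; rewrite in_itv /= => st.
  by have [] := phiD s st.
rewrite in_itv /= => /andP[xi0 xit].
have xitt : 0 <= xi <= t by rewrite !ltW.
rewrite subr0 {1 2}/phi !scale0r !add0r => phiE.
have -> : f (t *: u + (t *: v + x)) - f (t *: u + x) - f (t *: v + x) + f x
    = dphi xi * t by rewrite -phiE; ring.
set h := 'D_u f in dh h1 dphi phiD phiE *.
pose err k := h (k + x) - h x - 'D_k h x.
have -> : dphi xi * t - t * (t * 'D_v h x)
    = t * (err (xi *: u + t *: v) - err (xi *: u)).
  have Dh k : 'D_k h x = 'd h x k by exact: deriveE.
  have hE y : 'D_u f y = h y by [].
  have l1 : 'd h x (xi *: u + t *: v) = xi * 'd h x u + t * 'd h x v.
    by rewrite linearD !linearZ.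
  have l2 : 'd h x (xi *: u) = xi * 'd h x u by rewrite linearZ.
  by rewrite /err /dphi !hE addrA !Dh l1 l2; ring.
rewrite normrM gtr0_norm // [_ * (t * t)]mulrA mulrC ler_pM2r //.
apply: (le_trans (ler_normB _ _)).
apply: (@le_trans _ _ (e * `|xi *: u + t *: v| + e * `|xi *: u|)).
  apply: lerD; apply: h1.
    by apply: lt_le_trans (small _ _ xitt tt) _; rewrite ge_min lexx.
  by apply: lt_le_trans (small1 _ xitt) _; rewrite ge_min lexx.
rewrite -mulrDr -mulrA ler_pM2l // mulrDl mulrDl ![_ * t]mulrC lerD //.
  rewrite (le_trans (ler_normD _ _)) // !normrZ !gtr0_norm //.
  by rewrite lerD // ler_wpM2r // ltW.
by rewrite normrZ gtr0_norm // ler_wpM2r // ltW.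
Qed.

Theorem schwarz f x u v : (\forall y \near x, differentiable f y) ->
  differentiable (fun y => 'D_u f y) x ->
  differentiable (fun y => 'D_v f y) x ->
  'D_v (fun y => 'D_u f y) x = 'D_u (fun y => 'D_v f y) x.
Proof.
move=> df du dv; apply/eqP; rewrite -subr_eq0 -normr_eq0 eq_le normr_ge0 andbT.
apply/ler_addgt0Pl => e e0; rewrite addr0.
pose c := `|u| + `|v| + `|u| + (`|v| + `|u| + `|v|) + 1.
have c0 : 0 < c by rewrite ltr_wpDl // !addr_ge0.
have d0 : 0 < e / c by rewrite divr_gt0.
have [r r0 hr] := second_difference v df du d0.
have [q q0 hq] := second_difference u df dv d0.
pose t := Num.min r q / 2.
have t0 : 0 < t by rewrite divr_gt0 // lt_min r0.
have tlt : t < Num.min r q by rewrite /t ltr_pdivrMr // ltr_pMr ?ltr1n // lt_min r0.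
move: (tlt); rewrite lt_min => /andP[tr tq].
have := hr t t0 tr; have := hq t t0 tq.
rewrite [t *: v + (t *: u + x)]addrCA.
set a := 'D_v _ x; set b := 'D_u _ x; set p := f _.
set cu := `|v| + _ + _; set cv := `|u| + _ + _ => hb ha.
have tt0 : 0 < t * t by rewrite mulr_gt0.
rewrite -(ler_pM2r tt0) -{1}(gtr0_norm tt0) -normrM.
have -> : (a - b) * (t * t) = (p - f (t *: v + x) - f (t *: u + x) + f x
      - t * (t * b)) - (p - f (t *: u + x) - f (t *: v + x) + f x - t * (t * a)).
  by ring.
apply: (le_trans (ler_normB _ _)); apply: (le_trans (lerD hb ha)).
rewrite -mulrDl -mulrDr ler_pM2r // -[leRHS](divfK (lt0r_neq0 c0)) ler_pM2l //.
by rewrite -[c]/(cv + cu + 1) [cu + cv]addrC lerDl.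
Qed.

End Schwarz.

(** Differentiability is a local property. *)
Lemma near_eq_differentiable (R : realType) (V : normedModType R)
    (f g : V -> R) (x : V) :
  (\near x, f x = g x) -> differentiable f x -> differentiable g x.
Proof.
move=> fg df.
suff d0 : differentiable (g - f) x.
  by rewrite -(subrK f g); exact: differentiableD.
(* g - f vanishes near x, so that its differential at x is 0 *)
have c0 : continuous (\0 : {linear V -> R}) by exact: cst_continuous.
have e0 : (g - f) \o shift x
    = cst ((g - f) x) + (\0 : {linear V -> R}) +o_ 0 id.
  have fg0 : \forall k \near 0, f (k + x) = g (k + x).
    by move: fg; rewrite (near_shift 0) /= subr0.
  apply/eqaddoP => e e0; near=> k.
  have fgk : f (k + x) = g (k + x) by near: k.
  rewrite !fctE /= fgk (nbhs_singleton fg) !subrr addr0 subr0 normr0.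
  by rewrite mulr_ge0 // ltW.
by apply/diff_locallyP; rewrite (diff_unique c0 e0).
Unshelve. all: by end_near. Qed.

(** * The ring of smooth functions on an open set *)

Section Smooth.
Variable R : realType.
Local Notation E := 'rV[R]_4.
Variable U : set E.
Hypothesis oU : open U.
Implicit Types (f g : E -> R) (n : nat).

Lemma near_open (P : E -> Prop) x : U x -> (forall y, U y -> P y) -> \near x, P x.
Proof. by move=> Ux UP; apply: filterS UP _; exact: open_nbhs_nbhs. Qed.

Lemma partial_congr f g i x : (forall y, U y -> f y = g y) -> U x ->
  partial i f x = partial i g x.
Proof. by move=> fg Ux; apply: near_eq_derive; exact: near_open. Qed.

(** Smoothness to finite order, which allows induction: closure of order n + 1
    under products needs closure of order n for the partial derivatives. *)
Definition diffn n f := forall l x, (size l <= n)%N -> U x ->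
  differentiable (foldr (@partial R) f l) x.

Lemma smooth_diffn f : smooth_on U f <-> forall n, diffn n f.
Proof.
split=> [sf n l x _|sf l x]; first exact: sf.
by apply: (sf (size l)).
Qed.

Lemma diffnS n f : diffn n.+1 f <->
  (forall x, U x -> differentiable f x) /\ forall i, diffn n (partial i f).
Proof.
split=> [df|[df dp]].
  split=> [x|i l x sl Ux]; first exact: (df [::]).
  have := df (rcons l i) x; rewrite foldr_rcons size_rcons; exact.
move=> l; case/lastP: l => [|l i] x sl Ux; first exact: df.
by rewrite foldr_rcons; apply: dp => //; rewrite size_rcons in sl.
Qed.

Lemma diffn0 f : diffn 0 f <-> forall x, U x -> differentiable f x.
Proof.
by split=> [df x|df [|//] x _]; [exact: (df [::]) | exact: df].
Qed.

Lemma diffnW n f : diffn n.+1 f -> diffn n f.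
Proof. by move=> df l x sl; apply: df; exact: leqW. Qed.

Lemma diffn_congr n f g : (forall x, U x -> f x = g x) ->
  diffn n f -> diffn n g.
Proof.
elim: n f g => [|n IH] f g fg.
  move=> /diffn0 df; apply/diffn0 => x Ux.
  by apply: near_eq_differentiable (df x Ux); exact: near_open.
move=> /diffnS[df dp]; apply/diffnS; split=> [x Ux|i].
  by apply: near_eq_differentiable (df x Ux); exact: near_open.
by apply: IH (dp i) => x Ux; exact: partial_congr.
Qed.

Lemma diffnD n f g : diffn n f -> diffn n g -> diffn n (fun x => f x + g x).
Proof.
elim: n f g => [|n IH] f g.
  move=> /diffn0 df /diffn0 dg; apply/diffn0 => x Ux.
  by apply: differentiableD; [exact: df | exact: dg].
move=> /diffnS[df dfp] /diffnS[dg dgp]; apply/diffnS; split=> [x Ux|i].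
  by apply: differentiableD; [exact: df | exact: dg].
apply: diffn_congr (IH _ _ (dfp i) (dgp i)) => x Ux.
by rewrite /partial deriveD //; apply: diff_derivable; [exact: df|exact: dg].
Qed.

Lemma diffn_cst n (c : R) : diffn n (fun _ => c).
Proof.
elim: n c => [|n IH] c; first by apply/diffn0 => x Ux; exact: differentiable_cst.
apply/diffnS; split=> [x Ux|i]; first exact: differentiable_cst.
apply: diffn_congr (IH 0) => x Ux.
by rewrite /partial derive_cst.
Qed.

Lemma diffnM n f g : diffn n f -> diffn n g -> diffn n (fun x => f x * g x).
Proof.
elim: n f g => [|n IH] f g.
  move=> /diffn0 df /diffn0 dg; apply/diffn0 => x Ux.
  by apply: differentiableM; [exact: df | exact: dg].
move=> sf sg; have [df dfp] := (diffnS _ _).1 sf.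
have [dg dgp] := (diffnS _ _).1 sg.
apply/diffnS; split=> [x Ux|i].
  by apply: differentiableM; [exact: df | exact: dg].
apply: diffn_congr (diffnD (IH _ _ (diffnW sf) (dgp i))
                           (IH _ _ (diffnW sg) (dfp i))) => x Ux.
by rewrite /partial deriveM //; apply: diff_derivable; [exact: df|exact: dg].
Qed.

Lemma diffnV n f : (forall x, U x -> f x != 0) -> diffn n f ->
  diffn n (fun x => (f x)^-1).
Proof.
move=> f0; elim: n => [|n IH].
  move=> /diffn0 df; apply/diffn0 => x Ux.
  by apply: differentiableV; [exact: df | exact: f0].
move=> sf; have [df dfp] := (diffnS _ _).1 sf.
have iv := IH (diffnW sf).
apply/diffnS; split=> [x Ux|i].
  by apply: differentiableV; [exact: df | exact: f0].
apply: diffn_congr (diffnM (diffnM (diffnM (@diffn_cst n (-1)) iv) iv) (dfp i)).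
move=> x Ux; rewrite /partial deriveV; last 2 first.
- exact: f0.
- by apply: diff_derivable; exact: df.
by rewrite expr2 invfM mulN1r mulNr.
Qed.

End Smooth.

Section SmoothRing.
Variable R : realType.
Local Notation E := 'rV[R]_4.

(** A nonempty open set; a point is needed for 1 and 0 to differ in the ring of
    functions. *)
Record domain := Domain {
  carrier :> set E;
  carrier_open : open carrier;
  point0 : E;
  point0_in : carrier point0
}.
Arguments carrier_open : clear implicits.
Arguments point0_in : clear implicits.

(** Smooth functions on U are extended by 0, so that functions equal on U are
    equal. *)
Record sfun (U : domain) := SFun {
  sval :> E -> R;
  sval_smooth : smooth_on (carrier U) sval;
  sval_out : forall x, ~ carrier U x -> sval x = 0
}.

Variable U : domain.
Implicit Types f g : sfun U.

Lemma sfunP f g : (forall x, carrier U x -> f x = g x) -> f = g.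
Proof.
case: f g => [f sf f0] [g sg g0] /= fg.
have e : f = g.
  apply/funext => x; case: (pselect (carrier U x)) => [/fg //|nUx].
  by rewrite f0 // g0.
by subst g; congr SFun; exact: Prop_irrelevance.
Qed.

Definition mask (f : E -> R) : E -> R :=
  fun x => if `[< carrier U x >] then f x else 0.

Lemma maskE (f : E -> R) x : carrier U x -> mask f x = f x.
Proof. by move=> Ux; rewrite /mask asboolT. Qed.

Lemma mask_out (f : E -> R) x : ~ carrier U x -> mask f x = 0.
Proof. by move=> Ux; rewrite /mask asboolF. Qed.

Lemma mask_smooth (f : E -> R) : smooth_on (carrier U) f -> smooth_on (carrier U) (mask f).
Proof.
move=> /smooth_diffn sf; apply/smooth_diffn => n.
by apply: (diffn_congr (carrier_open U) _ (sf n)) => x Ux; rewrite maskE.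
Qed.

Definition smask (f : E -> R) (sf : smooth_on (carrier U) f) : sfun U :=
  SFun (mask_smooth sf) (@mask_out f).

Lemma smooth_cst c : smooth_on (carrier U) (fun _ => c).
Proof. by apply/smooth_diffn => n; exact: diffn_cst (carrier_open U) _ _. Qed.

Lemma smoothD (f g : E -> R) : smooth_on (carrier U) f -> smooth_on (carrier U) g ->
  smooth_on (carrier U) (fun x => f x + g x).
Proof.
move=> /smooth_diffn sf /smooth_diffn sg; apply/smooth_diffn => n.
exact: (diffnD (carrier_open U)).
Qed.

Lemma smoothM (f g : E -> R) : smooth_on (carrier U) f -> smooth_on (carrier U) g ->
  smooth_on (carrier U) (fun x => f x * g x).
Proof.
move=> /smooth_diffn sf /smooth_diffn sg; apply/smooth_diffn => n.
exact: (diffnM (carrier_open U)).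
Qed.

Lemma smoothV (f : E -> R) : (forall x, carrier U x -> f x != 0) -> smooth_on (carrier U) f ->
  smooth_on (carrier U) (fun x => (f x)^-1).
Proof.
move=> f0 /smooth_diffn sf; apply/smooth_diffn => n.
exact: (diffnV (carrier_open U)).
Qed.

Lemma smooth_partial i (f : E -> R) : smooth_on (carrier U) f ->
  smooth_on (carrier U) (partial i f).
Proof.
move=> /smooth_diffn sf; apply/smooth_diffn => n.
exact: ((diffnS _ _ _).1 (sf n.+1)).2.
Qed.

Definition sadd f g := smask (smoothD (sval_smooth f) (sval_smooth g)).
Definition smul f g := smask (smoothM (sval_smooth f) (sval_smooth g)).
Definition scst c := smask (smooth_cst c).
Definition sopp f := smul (scst (-1)) f.

HB.instance Definition _ := gen_eqMixin (sfun U).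
HB.instance Definition _ := gen_choiceMixin (sfun U).

Lemma saddA : associative sadd.
Proof. by move=> f g h; apply: sfunP => x Ux; rewrite /= !maskE // addrA. Qed.

Lemma saddC : commutative sadd.
Proof. by move=> f g; apply: sfunP => x Ux; rewrite /= !maskE // addrC. Qed.

Lemma sadd0 : left_id (scst 0) sadd.
Proof. by move=> f; apply: sfunP => x Ux; rewrite /= !maskE // add0r. Qed.

Lemma saddN : left_inverse (scst 0) sopp sadd.
Proof.
by move=> f; apply: sfunP => x Ux; rewrite /= !maskE // mulN1r addNr.
Qed.

HB.instance Definition _ :=
  GRing.isZmodule.Build (sfun U) saddA saddC sadd0 saddN.

Lemma smulA : associative smul.
Proof. by move=> f g h; apply: sfunP => x Ux; rewrite /= !maskE // mulrA. Qed.

Lemma smulC : commutative smul.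
Proof. by move=> f g; apply: sfunP => x Ux; rewrite /= !maskE // mulrC. Qed.

Lemma smul1 : left_id (scst 1) smul.
Proof. by move=> f; apply: sfunP => x Ux; rewrite /= !maskE // mul1r. Qed.

Lemma smulDl : left_distributive smul +%R.
Proof.
by move=> f g h; apply: sfunP => x Ux; rewrite /= !maskE // mulrDl.
Qed.

Lemma scst1_neq0 : scst 1 != 0.
Proof.
apply/eqP => /(congr1 (fun f : sfun U => f (point0 U))).
rewrite /= !maskE; try exact: point0_in.
by move/eqP; rewrite oner_eq0.
Qed.

HB.instance Definition _ := GRing.Zmodule_isComNzRing.Build (sfun U)
  smulA smulC smul1 smulDl scst1_neq0.

Lemma evalD f g x : carrier U x -> (f + g) x = f x + g x.
Proof. exact: maskE. Qed.

Lemma evalM f g x : carrier U x -> (f * g) x = f x * g x.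
Proof. exact: maskE. Qed.

Lemma evalN f x : carrier U x -> (- f) x = - f x.
Proof. by move=> Ux; rewrite /= !maskE // mulN1r. Qed.

Lemma eval0 x : (0 : sfun U) x = 0.
Proof. by rewrite /= /mask if_same. Qed.

Lemma eval1 x : carrier U x -> (1 : sfun U) x = 1.
Proof. exact: maskE. Qed.

Lemma eval_sum n (F : 'I_n -> sfun U) x : carrier U x ->
  (\sum_i F i) x = \sum_i F i x.
Proof.
move=> Ux; apply: (big_morph (fun f : sfun U => f x)) => [f g|].
  exact: evalD.
exact: eval0.
Qed.

Definition spartial i f := smask (smooth_partial i (sval_smooth f)).

Lemma spartialE i f x : carrier U x -> spartial i f x = partial i f x.
Proof. exact: maskE. Qed.

Lemma sderivable f x v : carrier U x -> derivable f x v.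
Proof.
by move=> Ux; apply: diff_derivable; exact: (sval_smooth f [::] Ux).
Qed.

Lemma partial_congr_in (f g : E -> R) i x :
  (forall y, carrier U y -> f y = g y) -> carrier U x -> partial i f x = partial i g x.
Proof. exact: partial_congr (carrier_open U) _ _ _ _. Qed.

Lemma spartialD i f g : spartial i (f + g) = spartial i f + spartial i g.
Proof.
apply: sfunP => x Ux; rewrite evalD // !spartialE //.
rewrite (@partial_congr_in _ (fun x => f x + g x)) //; last by move=> y; exact: maskE.
by rewrite /partial deriveD //; exact: sderivable.
Qed.

Lemma spartialM i f g :
  spartial i (f * g) = spartial i f * g + f * spartial i g.
Proof.
apply: sfunP => x Ux; rewrite evalD // !evalM // !spartialE //.
rewrite (@partial_congr_in _ (fun x => f x * g x)) //; last by move=> y; exact: maskE.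
rewrite /partial deriveM //; try exact: sderivable.
by rewrite addrC; congr (_ + _); rewrite mulrC.
Qed.

(** This is where the analysis enters: partial derivatives commute. *)
Lemma spartialC i j f : spartial i (spartial j f) = spartial j (spartial i f).
Proof.
apply: sfunP => x Ux.
have e k l : spartial k (spartial l f) x = partial k (partial l f) x.
  transitivity (partial k (spartial l f) x); first exact: spartialE.
  exact: (partial_congr_in k (fun y => @spartialE l f y) Ux).
apply: (etrans (e i j)); apply: esym; apply: (etrans (e j i)); apply: esym.
apply: schwarz; last 2 first.
- exact: (sval_smooth f [:: j] Ux).
- exact: (sval_smooth f [:: i] Ux).
by apply: (near_open (carrier_open U)) => // y; exact: (sval_smooth f [::]).
Qed.

Lemma shalf2 : scst 2^-1 + scst 2^-1 = 1.
Proof.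
by apply: sfunP => x Ux; rewrite evalD // eval1 // /= !maskE //; field.
Qed.

Definition sder : derivations (sfun U) :=
  Derivations shalf2 spartialD spartialM spartialC.

Lemma sfun_inv f : (forall x, carrier U x -> f x != 0) -> exists g, g * f = 1.
Proof.
move=> f0; exists (smask (smoothV f0 (sval_smooth f))).
apply: sfunP => x Ux; rewrite evalM // eval1 //= maskE // mulVf //.
exact: f0.
Qed.

End SmoothRing.

(** * Alternating sums over permutations and index functions *)

Definition b0 : 'I_2 := @Ordinal 2 0 isT.
Definition b1 : 'I_2 := @Ordinal 2 1 isT.
Definition c0 : 'I_3 := @Ordinal 3 0 isT.
Definition c1 : 'I_3 := @Ordinal 3 1 isT.
Definition c2 : 'I_3 := @Ordinal 3 2 isT.

Lemma sum2 (W : nmodType) (F : 'I_2 -> W) : \sum_(i < 2) F i = F b0 + F b1.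
Proof.
by rewrite !big_ord_recr /= big_ord0 add0r; congr (F _ + F _); apply/val_inj.
Qed.

Lemma sum3 (W : nmodType) (F : 'I_3 -> W) :
  \sum_(i < 3) F i = F c0 + F c1 + F c2.
Proof.
rewrite !big_ord_recr /= big_ord0 add0r.
by congr (F _ + F _ + F _); apply/val_inj.
Qed.

(** A permutation of n + 1 elements is given by the image of the first one and by
    a permutation of n elements. *)
Lemma sum_perm (W : nmodType) n (F : 'S_n.+1 -> W) :
  \sum_p F p = \sum_i \sum_(q : 'S_n) F (lift_perm ord0 i q).
Proof.
rewrite pair_bigA /=.
pose f (iq : 'I_n.+1 * 'S_n) := lift_perm ord0 iq.1 iq.2.
rewrite (reindex f) //; apply: onW_bij.
apply: inj_card_bij => [[i q] [j r]|]; rewrite /f /=.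
  move=> /permP e; have eij : i = j.
    by have := e ord0; rewrite !lift_perm_id.
  rewrite -eij in e *; congr (_, _); apply/permP => k.
  by have := e (lift ord0 k); rewrite !lift_perm_lift => /lift_inj.
by rewrite card_prod card_ord -!cardsT !cardsE !card_Sn factS.
Qed.

Lemma sum_perm0 (W : nmodType) (F : 'S_0 -> W) : \sum_p F p = F 1%g.
Proof.
rewrite (big_pred1 1%g) // => p; apply/esym/eqP/permP; case=> //.
Qed.

Lemma lift_tab : (((lift o0 c0 = o1) * (lift o0 c1 = o2) * (lift o0 c2 = o3))
 * ((lift o1 c0 = o0) * (lift o1 c1 = o2) * (lift o1 c2 = o3))
 * ((lift o2 c0 = o0) * (lift o2 c1 = o1) * (lift o2 c2 = o3))
 * ((lift o3 c0 = o0) * (lift o3 c1 = o1) * (lift o3 c2 = o2))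
 * ((lift c0 b0 = c1) * (lift c0 b1 = c2) * (lift c1 b0 = c0)
   * (lift c1 b1 = c2) * (lift c2 b0 = c0) * (lift c2 b1 = c1))
 * ((lift b0 (@ord0 0) = b1) * (lift b1 (@ord0 0) = b0)))%type.
Proof. by do !split; apply: val_inj. Qed.

Lemma lift_perm_vals3 i (q : 'S_3) : (((lift_perm ord0 i q) o0 = i)
  * ((lift_perm ord0 i q) o1 = lift i (q c0))
  * ((lift_perm ord0 i q) o2 = lift i (q c1))
  * ((lift_perm ord0 i q) o3 = lift i (q c2)))%type.
Proof.
have e0 : o0 = ord0 by apply: val_inj.
have e1 : o1 = lift ord0 c0 by apply: val_inj.
have e2 : o2 = lift ord0 c1 by apply: val_inj.
have e3 : o3 = lift ord0 c2 by apply: val_inj.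
by do !split; rewrite ?e1 ?e2 ?e3 ?lift_perm_lift // e0 lift_perm_id.
Qed.

Lemma lift_perm_vals2 i (q : 'S_2) : (((lift_perm ord0 i q) c0 = i)
  * ((lift_perm ord0 i q) c1 = lift i (q b0))
  * ((lift_perm ord0 i q) c2 = lift i (q b1)))%type.
Proof.
have e0 : c0 = ord0 by apply: val_inj.
have e1 : c1 = lift ord0 b0 by apply: val_inj.
have e2 : c2 = lift ord0 b1 by apply: val_inj.
by do !split; rewrite ?e1 ?e2 ?lift_perm_lift // e0 lift_perm_id.
Qed.

Lemma lift_perm_vals1 i (q : 'S_1) : (((lift_perm ord0 i q) b0 = i)
  * ((lift_perm ord0 i q) b1 = lift i ord0))%type.
Proof.
have e0 : b0 = ord0 by apply: val_inj.
have e1 : b1 = lift ord0 (@ord0 0) by apply: val_inj.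
split; first by rewrite e0 lift_perm_id.
by rewrite e1 lift_perm_lift; congr lift; exact: ord1.
Qed.

Section Sums.
Variable A : comNzRingType.

Lemma signed_sum2 (F : 'I_2 -> 'I_2 -> A) :
  \sum_(p : 'S_2) (-1) ^+ odd_perm p * F (p b0) (p b1) = F b0 b1 - F b1 b0.
Proof.
rewrite sum_perm sum2; under eq_bigr do rewrite !lift_perm_vals1.
under [X in _ + X]eq_bigr do rewrite !lift_perm_vals1.
rewrite !sum_perm !big_ord_recr !big_ord0 !sum_perm0 !odd_lift_perm !odd_perm1.
by rewrite !lift_tab /=; ring.
Qed.

Lemma signed_sum3 (F : 'I_3 -> 'I_3 -> 'I_3 -> A) :
  \sum_(p : 'S_3) (-1) ^+ odd_perm p * F (p c0) (p c1) (p c2)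
  = F c0 c1 c2 - F c0 c2 c1 - F c1 c0 c2 + F c1 c2 c0 + F c2 c0 c1 - F c2 c1 c0.
Proof.
rewrite sum_perm.
have e i : \sum_(q : 'S_2) (-1) ^+ odd_perm (lift_perm ord0 i q)
     * F ((lift_perm ord0 i q) c0) ((lift_perm ord0 i q) c1)
         ((lift_perm ord0 i q) c2)
   = (-1) ^+ odd i * (F i (lift i b0) (lift i b1) - F i (lift i b1) (lift i b0)).
  rewrite -(signed_sum2 (fun j k => F i (lift i j) (lift i k))) mulr_sumr.
  apply: eq_bigr => q _; rewrite !lift_perm_vals2 odd_lift_perm /= mulrA.
  by rewrite signr_addb.
rewrite (eq_bigr _ (fun i _ => e i)) sum3 !lift_tab /=; ring.
Qed.

Lemma signed_sum4 (F : 'I_4 -> 'I_4 -> 'I_4 -> 'I_4 -> A) :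
  \sum_(p : 'S_4) (-1) ^+ odd_perm p * F (p o0) (p o1) (p o2) (p o3)
  = \sum_(i < 4) (-1) ^+ odd i *
    (let G j k l := F i (lift i j) (lift i k) (lift i l) in
     G c0 c1 c2 - G c0 c2 c1 - G c1 c0 c2 + G c1 c2 c0 + G c2 c0 c1 - G c2 c1 c0).
Proof.
rewrite sum_perm; apply: eq_bigr => i _ /=.
rewrite -(signed_sum3 (fun j k l => F i (lift i j) (lift i k) (lift i l))).
rewrite mulr_sumr; apply: eq_bigr => q _.
by rewrite !lift_perm_vals3 odd_lift_perm /= mulrA signr_addb.
Qed.

Lemma signed_wedge22 (B C : 'M[A]_4) (s : 'I_4 -> 'I_4) :
  B^T = - B -> C^T = - C ->
  \sum_(p : 'S_4) (-1) ^+ odd_perm p *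
    (B (s (p o0)) (s (p o1)) * C (s (p o2)) (s (p o3)))
  = 4%:R * wedge22 B C (s o0) (s o1) (s o2) (s o3).
Proof.
move=> /skewE b /skewE c.
rewrite (signed_sum4 (fun i j k l => B (s i) (s j) * C (s k) (s l))).
rewrite sum4 /= !lift_tab /wedge22.
rewrite (b (s o0) (s o1)) (b (s o0) (s o2)) (b (s o0) (s o3)).
rewrite (b (s o1) (s o2)) (b (s o1) (s o3)) (b (s o2) (s o3)).
rewrite (c (s o0) (s o1)) (c (s o0) (s o2)) (c (s o0) (s o3)).
rewrite (c (s o1) (s o2)) (c (s o1) (s o3)) (c (s o2) (s o3)).
by rewrite !expr0 !expr1; ring.
Qed.

Lemma signed_wedge12 (e : 'I_4 -> A) (C : 'M[A]_4) (s : 'I_3 -> 'I_4) :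
  C^T = - C ->
  \sum_(p : 'S_3) (-1) ^+ odd_perm p *
    (e (s (p c0)) * C (s (p c1)) (s (p c2)))
  = 2%:R * wedge12 e C (s c0) (s c1) (s c2).
Proof.
move=> /skewE c.
rewrite (signed_sum3 (fun i j k => e (s i) * C (s j) (s k))) /wedge12.
rewrite (c (s c0) (s c1)) (c (s c0) (s c2)) (c (s c1) (s c2)).
by ring.
Qed.

Lemma sum_ffun2 (T : finType) (F : {ffun 'I_2 -> T} -> A) (h : T -> T -> A) :
  (forall r, F r = h (r b0) (r b1)) -> \sum_r F r = \sum_i \sum_j h i j.
Proof.
move=> e; rewrite (eq_bigr _ (fun r _ => e r)) pair_bigA /=.
pose f (p : T * T) : {ffun 'I_2 -> T} :=
  [ffun i : 'I_2 => if val i == 0%N then p.1 else p.2].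
rewrite (reindex f); first by apply: eq_bigr => -[i j] _; rewrite /f !ffunE.
exists (fun r : {ffun 'I_2 -> T} => (r b0, r b1)) => [[i j] _|r _]; first by rewrite /f !ffunE.
apply/ffunP => i; rewrite ffunE /=; case: i => [[|[|//]]] lt /=;
  by congr (r _); apply: val_inj.
Qed.

Lemma sum_ffun4 (T : finType) (F : {ffun 'I_4 -> T} -> A)
    (h : T -> T -> T -> T -> A) :
  (forall r, F r = h (r o0) (r o1) (r o2) (r o3)) ->
  \sum_r F r = \sum_i \sum_j \sum_k \sum_l h i j k l.
Proof.
move=> e; rewrite (eq_bigr _ (fun r _ => e r)) pair_bigA /=.
rewrite (pair_bigA _ (fun p k => \sum_l h p.1 p.2 k l)) /=.
rewrite (pair_bigA _ (fun p l => h p.1.1 p.1.2 p.2 l)) /=.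
pose f (p : T * T * T * T) : {ffun 'I_4 -> T} := [ffun i : 'I_4 =>
  if val i == 0%N then p.1.1.1 else if val i == 1%N then p.1.1.2
  else if val i == 2 then p.1.2 else p.2].
rewrite (reindex f).
  by apply: eq_bigr => -[[[i j] k] l] _; rewrite /f !ffunE.
exists (fun r : {ffun 'I_4 -> T} => (r o0, r o1, r o2, r o3)) => [[[[i j] k] l] _|r _].
  by rewrite /f !ffunE.
apply/ffunP; elim/ord4_ind; by rewrite ffunE.
Qed.

(** The full contraction of two alternating arrays has 24 equal nonzero terms. *)
Lemma sum_alt4 (c : A) (f h : 'I_4 -> 'I_4 -> 'I_4 -> 'I_4 -> A) :
  c + c = 1 -> alt4 f -> alt4 h ->
  \sum_i \sum_j \sum_k \sum_l f i j k l * h i j k l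
  = 24%:R * (f o0 o1 o2 o3 * h o0 o1 o2 o3).
Proof.
move=> c2 [f1 f2 f3] [h1 h2 h3].
pose F i j k l := f i j k l * h i j k l.
have F1 i j k l : F j i k l = F i j k l by rewrite /F f1 h1 mulrNN.
have F2 i j k l : F i k j l = F i j k l by rewrite /F f2 h2 mulrNN.
have F3 i j k l : F i j l k = F i j k l by rewrite /F f3 h3 mulrNN.
have z1 i k l : F i i k l = 0.
  by rewrite /F (addrr_eq0 c2 (a := f i i k l)) ?mul0r // {1}f1 addNr.
have z2 i j l : F i j j l = 0.
  by rewrite /F (addrr_eq0 c2 (a := f i j j l)) ?mul0r // {1}f2 addNr.
have z3 i j k : F i j k k = 0.
  by rewrite /F (addrr_eq0 c2 (a := f i j k k)) ?mul0r // {1}f3 addNr.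
pose sort1 := (F1 o0 o1, F1 o0 o2, F1 o0 o3, F1 o1 o2, F1 o1 o3, F1 o2 o3).
pose sort2 := ((fun i => F2 i o0 o1), (fun i => F2 i o0 o2),
  (fun i => F2 i o0 o3), (fun i => F2 i o1 o2), (fun i => F2 i o1 o3),
  (fun i => F2 i o2 o3)).
pose sort3 := ((fun i j => F3 i j o0 o1), (fun i j => F3 i j o0 o2),
  (fun i j => F3 i j o0 o3), (fun i j => F3 i j o1 o2),
  (fun i j => F3 i j o1 o3), (fun i j => F3 i j o2 o3)).
pose G i j := \sum_k \sum_l F i j k l.
have G0 i : G i i = 0 by rewrite /G big1 // => k _; rewrite big1.
have G1 i j : G j i = G i j.
  by apply: eq_bigr => k _; apply: eq_bigr => l _; exact: F1.
pose F0 := 2%:R * F o0 o1 o2 o3.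
have g1 : G o0 o1 = F0.
  by rewrite /G !sum4 ?(sort1, sort2, sort3) ?(z1, z2, z3) /F0; ring.
have g2 : G o0 o2 = F0.
  by rewrite /G !sum4 ?(sort1, sort2, sort3) ?(z1, z2, z3) /F0; ring.
have g3 : G o0 o3 = F0.
  by rewrite /G !sum4 ?(sort1, sort2, sort3) ?(z1, z2, z3) /F0; ring.
have g4 : G o1 o2 = F0.
  by rewrite /G !sum4 ?(sort1, sort2, sort3) ?(z1, z2, z3) /F0; ring.
have g5 : G o1 o3 = F0.
  by rewrite /G !sum4 ?(sort1, sort2, sort3) ?(z1, z2, z3) /F0; ring.
have g6 : G o2 o3 = F0.
  by rewrite /G !sum4 ?(sort1, sort2, sort3) ?(z1, z2, z3) /F0; ring.
rewrite -[LHS]/(\sum_i \sum_j G i j) !sum4 !G0.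
rewrite (G1 o0 o1) (G1 o0 o2) (G1 o0 o3) (G1 o1 o2) (G1 o1 o3) (G1 o2 o3).
by rewrite g1 g2 g3 g4 g5 g6 /F0 /F; ring.
Qed.

Section RaiseForm.
Variables (G : 'M[A]_4).
Hypothesis G_sym : G^T = G.

Lemma raise2E (B : 'M[A]_4) i j :
  (G *m B *m G) i j = \sum_p \sum_q G i p * G j q * B p q.
Proof.
rewrite mulE; under eq_bigr do rewrite mulE mulr_suml.
rewrite exchange_big; apply: eq_bigr => p _; apply: eq_bigr => q _ /=.
by rewrite -{2}G_sym trE; ring.
Qed.

Let r12 (B C : 'M[A]_4) i j k l :
  \sum_p \sum_q \sum_u \sum_v
    G i p * G j q * G k u * G l v * (B p q * C u v)
  = (G *m B *m G) i j * (G *m C *m G) k l.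
Proof.
rewrite !raise2E mulr_suml; apply: eq_bigr => p _.
rewrite mulr_suml; apply: eq_bigr => q _.
rewrite mulr_sumr; apply: eq_bigr => u _.
by rewrite mulr_sumr; apply: eq_bigr => v _; ring.
Qed.

Let r13 (B C : 'M[A]_4) i j k l :
  \sum_p \sum_q \sum_u \sum_v
    G i p * G j q * G k u * G l v * (B p u * C q v)
  = (G *m B *m G) i k * (G *m C *m G) j l.
Proof.
rewrite -r12; apply: eq_bigr => p _; rewrite exchange_big.
by do 3!apply: eq_bigr => ? _; ring.
Qed.

Let r14 (B C : 'M[A]_4) i j k l :
  \sum_p \sum_q \sum_u \sum_v
    G i p * G j q * G k u * G l v * (B p v * C q u)
  = (G *m B *m G) i l * (G *m C *m G) j k.
Proof.
rewrite -r13; apply: eq_bigr => p _; apply: eq_bigr => q _.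
by rewrite exchange_big; do 2!apply: eq_bigr => ? _; ring.
Qed.

Lemma raise_wedge22 (B C : 'M[A]_4) i j k l :
  \sum_p \sum_q \sum_u \sum_v
    G i p * G j q * G k u * G l v * wedge22 B C p q u v
  = wedge22 (G *m B *m G) (G *m C *m G) i j k l.
Proof.
have -> : wedge22 (G *m B *m G) (G *m C *m G) i j k l =
    (G *m B *m G) i j * (G *m C *m G) k l
    - (G *m B *m G) i k * (G *m C *m G) j l
    + (G *m B *m G) i l * (G *m C *m G) j k
    + (G *m C *m G) i l * (G *m B *m G) j k
    - (G *m C *m G) i k * (G *m B *m G) j l
    + (G *m C *m G) i j * (G *m B *m G) k l by rewrite /wedge22; ring.
rewrite -(r12 B C i j) -(r13 B C i) -(r14 B C i) -(r14 C B i) -(r13 C B i).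
rewrite -(r12 C B i j) -!sumrN -!big_split; apply: eq_bigr => p _ /=.
rewrite -!sumrN -!big_split; apply: eq_bigr => q _ /=.
rewrite -!sumrN -!big_split; apply: eq_bigr => u _ /=.
rewrite -!sumrN -!big_split; apply: eq_bigr => v _ /=.
by rewrite /wedge22; ring.
Qed.
End RaiseForm.

Lemma wedge22_skewr (G B : 'M[A]_4) : G^T = G -> B^T = - B ->
  (G *m B *m G)^T = - (G *m B *m G).
Proof. by move=> sG sB; rewrite 2!trM sG sB mmNl mmNr mmA. Qed.

End Sums.

(** * Wedge products and Hodge stars in components *)

Section FormsAtAPoint.
Variables (R : realType) (x : 'rV[R]_4).

Lemma ct_wedge11 (a b : ctensor R 1) (e f : 'I_4 -> R) s :
  (forall s, a x s = e (s ord0)) -> (forall s, b x s = f (s ord0)) ->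
  wedge a b x s = wedge11 e f (s b0) (s b1).
Proof.
move=> ha hb; rewrite wedge11E /wedge.
have l0 : lshift 1 (@ord0 0) = b0 by apply: val_inj.
have l1 : rshift 1 (@ord0 0) = b1 by apply: val_inj.
under eq_bigr do rewrite ha hb l0 l1.
rewrite (signed_sum2 (fun i j => e (s i) * f (s j))).
by rewrite invr1 mul1r mulrC [f _ * _]mulrC [e (s b1) * _]mulrC; ring.
Qed.

Lemma ct_wedge12 (a : ctensor R 1) (b : ctensor R 2) (e : 'I_4 -> R)
    (B : 'M[R]_4) s : B^T = - B ->
  (forall s, a x s = e (s ord0)) -> (forall s, b x s = B (s b0) (s b1)) ->
  wedge a b x s = wedge12 e B (s c0) (s c1) (s c2).
Proof.
move=> sB ha hb; rewrite /wedge.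
have l0 : lshift 2 (@ord0 0) = c0 by apply: val_inj.
have l1 : rshift 1 b0 = c1 by apply: val_inj.
have l2 : rshift 1 b1 = c2 by apply: val_inj.
under eq_bigr do rewrite ha hb l0 l1 l2.
rewrite (signed_wedge12 e s sB) mulrA.
by rewrite (_ : (1`! * 2`!)%:R^-1 * 2%:R = 1) ?mul1r // mulVf // pnatr_eq0.
Qed.

Lemma ct_wedge22 (a b : ctensor R 2) (B C : 'M[R]_4) s :
  B^T = - B -> C^T = - C ->
  (forall s, a x s = B (s b0) (s b1)) -> (forall s, b x s = C (s b0) (s b1)) ->
  wedge a b x s = wedge22 B C (s o0) (s o1) (s o2) (s o3).
Proof.
move=> sB sC ha hb; rewrite /wedge.
have l0 : lshift 2 b0 = o0 by apply: val_inj.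
have l1 : lshift 2 b1 = o1 by apply: val_inj.
have l2 : rshift 2 b0 = o2 by apply: val_inj.
have l3 : rshift 2 b1 = o3 by apply: val_inj.
under eq_bigr do rewrite ha hb l0 l1 l2 l3.
rewrite (signed_wedge22 s sB sC) mulrA.
by rewrite (_ : (2`! * 2`!)%:R^-1 * 4%:R = 1) ?mul1r // mulVf // pnatr_eq0.
Qed.

Lemma cat_indexl k l (r : 'I_k -> 'I_4) (s : 'I_l -> 'I_4) i :
  cat_index r s (lshift l i) = r i.
Proof. by rewrite /cat_index (unsplitK (inl i)). Qed.

Lemma cat_indexr k l (r : 'I_k -> 'I_4) (s : 'I_l -> 'I_4) i :
  cat_index r s (rshift k i) = s i.
Proof. by rewrite /cat_index (unsplitK (inr i)). Qed.

Lemma ct_hodge22 (g : matrix_field R) (vol : ctensor R 4) (b : ctensor R 2)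
    (B : 'M[R]_4) (v : 'I_4 -> 'I_4 -> 'I_4 -> 'I_4 -> R) (s : 'I_2 -> 'I_4) :
  (forall s, vol x s = v (s o0) (s o1) (s o2) (s o3)) ->
  (forall s, b x s = B (s b0) (s b1)) ->
  let G := invmx (g x) in G^T = G ->
  hodge g (k := 2) (l := 2) vol b x s
  = 2^-1 * \sum_i \sum_j (G *m B *m G) i j * v i j (s b0) (s b1).
Proof.
move=> hv hb G sG; rewrite /hodge; congr (_ * _).
have l0 : o0 = lshift 2 b0 by apply: val_inj.
have l1 : o1 = lshift 2 b1 by apply: val_inj.
have l2 : o2 = rshift 2 b0 by apply: val_inj.
have l3 : o3 = rshift 2 b1 by apply: val_inj.
apply: (sum_ffun2 (h := fun i j => (G *m B *m G) i j * v i j (s b0) (s b1))).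
move=> r; rewrite hv l0 l1 l2 l3 !cat_indexl !cat_indexr; congr (_ * _).
rewrite /raise.
rewrite (sum_ffun2 (h := fun p q => G (r b0) p * G (r b1) q * B p q)); last first.
  move=> t; rewrite hb; congr (_ * _).
  rewrite !big_ord_recl big_ord0 mulr1 /ginv -/G.
  by congr (G (r _) (t _) * G (r _) (t _)); apply: val_inj.
rewrite mulE; under [RHS]eq_bigr do rewrite mulE mulr_suml.
rewrite exchange_big; apply: eq_bigr => q _; apply: eq_bigr => p _ /=.
by rewrite -{2}sG trE; ring.
Qed.

Lemma ct_hodge40 (g : matrix_field R) (vol a : ctensor R 4)
    (B C : 'M[R]_4) (v : 'I_4 -> 'I_4 -> 'I_4 -> 'I_4 -> R) (s : 'I_0 -> 'I_4) :
  B^T = - B -> C^T = - C -> alt4 v ->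
  (forall s, vol x s = v (s o0) (s o1) (s o2) (s o3)) ->
  (forall s, a x s = wedge22 B C (s o0) (s o1) (s o2) (s o3)) ->
  let G := invmx (g x) in G^T = G ->
  hodge g (k := 4) (l := 0) vol a x s
  = wedge22 (G *m B *m G) (G *m C *m G) o0 o1 o2 o3 * v o0 o1 o2 o3.
Proof.
move=> sB sC av hv ha G sG; rewrite /hodge.
set M := G *m B *m G; set N := G *m C *m G.
have h2 : 2^-1 + 2^-1 = 1 :> R by field.
have l4 : forall i : 'I_4, lshift 0 i = i by move=> i; apply: val_inj.
rewrite (sum_ffun4 (h := fun i j k l => wedge22 M N i j k l * v i j k l)).
  rewrite (sum_alt4 h2) // ?mulrA; last by apply: wedge22_alt; exact: wedge22_skewr.
  by rewrite (_ : (4`!)%:R^-1 * 24%:R = 1) ?mul1r // mulVf // pnatr_eq0.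
move=> r; rewrite hv.
have ci i : cat_index r s i = r i by rewrite -{1}(l4 i) cat_indexl.
rewrite !ci; congr (_ * _); rewrite /raise -raise_wedge22 //.
apply: (sum_ffun4 (h := fun p q u w =>
  G (r o0) p * G (r o1) q * G (r o2) u * G (r o3) w * wedge22 B C p q u w)).
move=> t; rewrite ha; congr (_ * _).
rewrite !big_ord_recr big_ord0 /= mul1r /ginv -/G.
by congr (G (r _) (t _) * G (r _) (t _) * G (r _) (t _) * G (r _) (t _));
  apply: val_inj.
Qed.

End FormsAtAPoint.

(** * Tensor fields as elements of the ring of smooth functions *)

Section MapForms.
Variables (A B : comNzRingType) (f : {rmorphism A -> B}).

Lemma map_pf (M : 'M[A]_4) i j k l :
  pf (map_mx f M) i j k l = f (pf M i j k l).
Proof. by rewrite /pf !(rmorphD, rmorphN, rmorphM) !mxE. Qed.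

Lemma map_wedge22 (M N : 'M[A]_4) i j k l :
  wedge22 (map_mx f M) (map_mx f N) i j k l = f (wedge22 M N i j k l).
Proof.
by rewrite /wedge22 !(rmorphD, rmorphN, rmorphM) !mxE.
Qed.

Lemma map_wedge12 (e : 'I_4 -> A) (M : 'M[A]_4) i j k :
  wedge12 (f \o e) (map_mx f M) i j k = f (wedge12 e M i j k).
Proof. by rewrite /wedge12 !(rmorphD, rmorphN, rmorphM) !mxE. Qed.

Lemma map_wedge11 (e e' : 'I_4 -> A) i j :
  wedge11 (f \o e) (f \o e') i j = f (wedge11 e e' i j).
Proof. by rewrite !wedge11E rmorphB !rmorphM. Qed.

End MapForms.

Section Representation.
Variables (R : realType) (U : domain R).
Local Notation A := (sfun U).
Local Notation D := (sder U).

(** All operators on tensor fields are local, so that it is enough to know the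
    components on U. The lemmas [rep_*] translate each operator into the ring
    of smooth functions. *)
Definition rep (f : 'rV[R]_4 -> R) (F : A) :=
  forall y, carrier U y -> f y = F y.

Lemma rep_mask f (sf : smooth_on (carrier U) f) : rep f (smask sf).
Proof. by move=> y Uy; rewrite /= maskE. Qed.

Lemma rep_cst c : rep (fun _ => c) (scst U c).
Proof. by move=> y Uy; rewrite /= maskE. Qed.

Lemma repD f g F G : rep f F -> rep g G -> rep (fun x => f x + g x) (F + G).
Proof. by move=> hf hg y Uy; rewrite evalD // -hf // -hg. Qed.

Lemma repM f g F G : rep f F -> rep g G -> rep (fun x => f x * g x) (F * G).
Proof. by move=> hf hg y Uy; rewrite evalM // -hf // -hg. Qed.

Lemma repN f F : rep f F -> rep (fun x => - f x) (- F).
Proof. by move=> hf y Uy; rewrite evalN // -hf. Qed.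

Lemma repB f g F G : rep f F -> rep g G -> rep (fun x => f x - g x) (F - G).
Proof. by move=> hf hg; apply: repD => //; exact: repN. Qed.

Lemma rep_sum n f (F : 'I_n -> A) : (forall i, rep (f i) (F i)) ->
  rep (fun x => \sum_i f i x) (\sum_i F i).
Proof.
by move=> h y Uy; rewrite eval_sum //; apply: eq_bigr => i _; exact: h.
Qed.

Lemma rep_partial i f F : rep f F -> rep (partial i f) (D i F).
Proof.
move=> h y Uy; apply: etrans (esym (spartialE i F Uy)).
exact: (partial_congr_in i h Uy).
Qed.

Definition ev y (Uy : carrier U y) (F : A) : R := F y.

Section Eval.
Variables (y : 'rV[R]_4) (Uy : carrier U y).

Lemma ev_is_zmod : zmod_morphism (ev Uy).
Proof. by move=> F G; rewrite /ev evalD // evalN. Qed.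

Lemma ev_is_monoid : monoid_morphism (ev Uy).
Proof. by split=> [|F G]; rewrite /ev ?eval1 ?evalM. Qed.

HB.instance Definition _ :=
  GRing.isZmodMorphism.Build A R (ev Uy) ev_is_zmod.
HB.instance Definition _ :=
  GRing.isMonoidMorphism.Build A R (ev Uy) ev_is_monoid.
End Eval.

Lemma mx_evP m n (M N : 'M[A]_(m, n)) :
  (forall y (Uy : carrier U y), map_mx (ev Uy) M = map_mx (ev Uy) N) -> M = N.
Proof.
move=> h; apply/matrixP => p q; apply: sfunP => y Uy.
by have /matrixP/(_ p q) := h y Uy; rewrite !mxE.
Qed.

Lemma ev_rep f F (h : rep f F) y (Uy : carrier U y) : ev Uy F = f y.
Proof. by rewrite h. Qed.

End Representation.

Section Local.
Variables (R : realType) (U : domain R).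
Variables (g J : matrix_field R) (V : vector_field R).
Local Notation A := (sfun U).
Local Notation D := (sder U).
Local Notation inU := (carrier U).

Hypothesis g_smooth : forall i j, smooth_on inU (fun x => g x i j).
Hypothesis J_smooth : forall i j, smooth_on inU (fun x => J x i j).
Hypothesis V_smooth : forall i, smooth_on inU (fun x => V x ord0 i).
Hypothesis g_sym : forall x, inU x -> forall i j, g x i j = g x j i.
Hypothesis g_pos : forall x, inU x -> forall v : 'rV[R]_4, v != 0 ->
  0 < \sum_(i < 4) \sum_(j < 4) g x i j * v ord0 i * v ord0 j.
Hypothesis J_sqr : forall x, inU x -> J x *m J x = - 1%:M.
Hypothesis J_orth : forall x, inU x -> (J x)^T *m g x *m J x = g x.
Hypothesis J_int : forall x, inU x -> forall k i j, nijenhuis J k i j x = 0.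
Hypothesis om_closed : forall x, inU x ->
  forall s, ext_d (kahler_form g J) x s = 0.
Hypothesis V_killing : forall x, inU x ->
  forall s, lie V (metric_tensor g) x s = 0.
Hypothesis V_sympl : forall x, inU x -> forall s, lie V (kahler_form g J) x s = 0.
Hypothesis g_flat : forall x, inU x -> scalar_curvature g x = 0.
Hypothesis V_neq0 : forall x, inU x -> V x != 0.

Definition gA : 'M[A]_4 := \matrix_(i, j) smask (g_smooth i j).
Definition JA : 'M[A]_4 := \matrix_(i, j) smask (J_smooth i j).
Definition VA i : A := smask (V_smooth i).

Lemma rep_g i j : rep (fun x => g x i j) (gA i j).
Proof. by rewrite mxE; exact: rep_mask. Qed.

Lemma rep_J i j : rep (fun x => J x i j) (JA i j).
Proof. by rewrite mxE; exact: rep_mask. Qed.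

Lemma rep_V i : rep (fun x => V x ord0 i) (VA i).
Proof. exact: rep_mask. Qed.

Lemma ev_g y (Uy : inU y) : map_mx (ev Uy) gA = g y.
Proof. by apply/matrixP => i j; rewrite mxE (ev_rep (rep_g i j)). Qed.

Lemma ev_J y (Uy : inU y) : map_mx (ev Uy) JA = J y.
Proof. by apply/matrixP => i j; rewrite mxE (ev_rep (rep_J i j)). Qed.

(** A positive definite matrix has no kernel. *)
Lemma g_unit y : inU y -> g y \in unitmx.
Proof.
move=> Uy; apply/negPn/negP => ng.
have [v v0 vg] : exists2 v : 'rV[R]_4, v != 0 & v *m g y = 0.
  have : kermx (g y) != 0.
    by rewrite kermx_eq0 row_free_unit.
  move=> /rowV0Pn[v /sub_kermxP vg v0]; by exists v.
have := g_pos Uy v0.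
have -> : \sum_(i < 4) \sum_(j < 4) g y i j * v ord0 i * v ord0 j
   = \sum_j (v *m g y) ord0 j * v ord0 j.
  rewrite exchange_big; apply: eq_bigr => j _ /=; rewrite mulE mulr_suml.
  by apply: eq_bigr => i _; ring.
by rewrite vg big1 ?ltxx // => j _; rewrite mxE mul0r.
Qed.

(** The inverse metric is smooth by Cramer's rule. *)
Lemma exists_inverse : exists G : 'M[A]_4, G *m gA = 1%:M.
Proof.
have d0 y : inU y -> (\det gA) y != 0.
  move=> Uy; rewrite -[(\det gA) y]/(ev Uy (\det gA)) -det_map_mx ev_g.
  by have := g_unit Uy; rewrite unitmxE unitfE.
have [d hd] := sfun_inv d0.
exists (d *: \adj gA); rewrite -scalemxAl mul_adj_mx.
by apply/matrixP => i j; rewrite !mxE mulrnAr hd.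
Qed.

Section WithInverse.
Variable GA : 'M[A]_4.
Hypothesis GK : GA *m gA = 1%:M.

Lemma ev_G y (Uy : inU y) : map_mx (ev Uy) GA = invmx (g y).
Proof.
have := congr1 (map_mx (ev Uy)) GK; rewrite map_mxM ev_g map_mx1 => e.
by rewrite -[LHS]mulmx1 -(mulmxV (g_unit Uy)) mulmxA e mul1mx.
Qed.

Lemma rep_G i j : rep (fun x => ginv g x i j) (GA i j).
Proof.
by move=> y Uy; rewrite /ginv -(ev_G Uy) mxE.
Qed.

Lemma rep_christ k i j : rep (christoffel g k i j) (christ D gA GA i k j).
Proof.
rewrite christ.unlock mxE; apply: repM; first exact: rep_cst.
apply: rep_sum => l; apply: repM; first exact: rep_G.
by apply: repB; [apply: repD|]; apply: rep_partial; exact: rep_g.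
Qed.

Lemma rep_riemann l k i j :
  rep (riemann g l k i j) (curv D (christ D gA GA) i j l k).
Proof.
rewrite curv.unlock !(mxD, mxN, DmE) !mulE.
have -> : forall a b c d : A, a - b + c - d = a - b + (c - d).
  by move=> a b c d; rewrite addrA.
rewrite -sumrB; apply: repD.
  by apply: repB; apply: rep_partial; exact: rep_christ.
by apply: rep_sum => m; apply: repB; apply: repM; exact: rep_christ.
Qed.

Lemma rep_ricci j k : rep (ricci g j k) (ric D (christ D gA GA) j k).
Proof.
by rewrite ric.unlock mxE; apply: rep_sum => i; exact: rep_riemann.
Qed.

Lemma rep_om s : rep (fun x => kahler_form g J x s)
  ((JA^T *m gA) (s b0) (s b1)).
Proof.
rewrite mulE; apply: rep_sum => k; rewrite trE.
have -> : b0 = ord0 by apply: val_inj.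
have -> : b1 = ord_max by apply: val_inj.
by apply: repM; [exact: rep_J | exact: rep_g].
Qed.

Definition mk2 (i j : 'I_4) : 'I_2 -> 'I_4 := fun r => nth i [:: i; j] r.
Definition mk3 (i j k : 'I_4) : 'I_3 -> 'I_4 := fun r => nth i [:: i; j; k] r.

Lemma rep_lie2 (T : ctensor R 2) (TA : 'M[A]_4) i j :
  (forall s, rep (fun x => T x s) (TA (s b0) (s b1))) ->
  rep (fun x => lie V T x (mk2 i j))
    (\sum_k VA k * D k (TA i j) + \sum_k D i (VA k) * TA k j
     + \sum_k D j (VA k) * TA i k).
Proof.
move=> h; rewrite -addrA; apply: repD.
  apply: rep_sum => k; apply: repM; first exact: rep_V.
  exact: rep_partial (h (mk2 i j)).
have -> : (fun x => \sum_(r < 2) \sum_(k < 4)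
    partial (mk2 i j r) (fun y => V y ord0 k) x
    * T x (fun i0 => if i0 == r then k else mk2 i j i0))
  = (fun x => \sum_(k < 4) partial i (fun y => V y ord0 k) x * T x (mk2 k j)
   + \sum_(k < 4) partial j (fun y => V y ord0 k) x * T x (mk2 i k)).
  apply/funext => x; rewrite sum2; congr (_ + _); apply: eq_bigr => k _;
    congr (_ * _); congr (T x _); apply/funext => r; by case: r => [[|[|//]]] lt.
apply: repD; apply: rep_sum => k; (apply: repM; first exact: rep_partial (rep_V k)).
  exact: (h (mk2 k j)).
exact: (h (mk2 i k)).
Qed.

Lemma rep_ext_d1 (a : ctensor R 1) (e : 'I_4 -> A) s :
  (forall s, rep (fun x => a x s) (e (s ord0))) ->
  rep (fun x => ext_d a x s) (D (s b0) (e (s b1)) - D (s b1) (e (s b0))).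
Proof.
move=> h y Uy.
have h0 : rep (fun y => a y (fun j => s (lift b0 j))) (e (s b1)).
  by have := h (fun j => s (lift b0 j)); rewrite /= lift_tab.
have h1 : rep (fun y => a y (fun j => s (lift b1 j))) (e (s b0)).
  by have := h (fun j => s (lift b1 j)); rewrite /= lift_tab.
rewrite /ext_d sum2 expr0 mul1r expr1 mulN1r.
exact: (repB (rep_partial _ h0) (rep_partial _ h1) Uy).
Qed.

Lemma rep_ext_d2 (T : ctensor R 2) (TA : 'M[A]_4) i j k :
  (forall s, rep (fun x => T x s) (TA (s b0) (s b1))) ->
  rep (fun x => ext_d T x (mk3 i j k))
    (D i (TA j k) + - D j (TA i k) + D k (TA i j)).
Proof.
move=> h y Uy.
have h0 (t : 'I_3) : rep (fun y => T y (fun r => mk3 i j k (lift t r)))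
    (TA (mk3 i j k (lift t b0)) (mk3 i j k (lift t b1))).
  exact: (h (fun r => mk3 i j k (lift t r))).
have h1 := h0 c0; have h2 := h0 c1; have h3 := h0 c2.
rewrite !lift_tab in h1 h2 h3.
rewrite /ext_d sum3 expr0 mul1r expr1 mulN1r sqrrN expr1n mul1r.
exact: (repD (repD (rep_partial _ h1) (repN (rep_partial _ h2)))
  (rep_partial _ h3) Uy).
Qed.

Lemma rep_ext_d3 (T : ctensor R 3) (q : 'I_4 -> 'I_4 -> 'I_4 -> A) s :
  (forall s, rep (fun x => T x s) (q (s c0) (s c1) (s c2))) ->
  rep (fun x => ext_d T x s)
    (D (s o0) (q (s o1) (s o2) (s o3)) - D (s o1) (q (s o0) (s o2) (s o3))
     + D (s o2) (q (s o0) (s o1) (s o3)) - D (s o3) (q (s o0) (s o1) (s o2))).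
Proof.
move=> h y Uy.
have h0 (t : 'I_4) : rep (fun y => T y (fun r => s (lift t r)))
    (q (s (lift t c0)) (s (lift t c1)) (s (lift t c2))).
  exact: (h (fun r => s (lift t r))).
have h1 := h0 o0; have h2 := h0 o1; have h3 := h0 o2; have h4 := h0 o3.
rewrite !lift_tab in h1 h2 h3 h4.
rewrite /ext_d sum4 expr0 mul1r expr1 mulN1r sqrrN expr1n mul1r.
rewrite -[(-1) ^+ o3]signr_odd /= expr1 mulN1r.
exact: (repB (repD (repB (rep_partial _ h1) (rep_partial _ h2))
  (rep_partial _ h3)) (rep_partial _ h4) Uy).
Qed.

Let gA_sym : gA^T = gA.
Proof.
by apply: mx_evP => y Uy; rewrite -map_trmx ev_g; apply/matrixP => i j;
  rewrite mxE g_sym.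
Qed.

Let JA_sqr : JA *m JA = - 1%:M.
Proof.
by apply: mx_evP => y Uy; rewrite map_mxM map_mxN map_mx1 ev_J J_sqr.
Qed.

Let JA_orth : JA^T *m gA *m JA = gA.
Proof.
by apply: mx_evP => y Uy; rewrite !map_mxM -map_trmx ev_J ev_g J_orth.
Qed.

Let rep_eq0 f (F : A) : rep f F -> (forall y, inU y -> f y = 0) -> F = 0.
Proof. by move=> h f0; apply: sfunP => y Uy; rewrite -h // f0 // eval0. Qed.

Let omA := JA^T *m gA.

Let omA_skew : omA^T = - omA.
Proof.
have e : gA *m JA = - omA.
  by rewrite -{1}JA_orth -mmA JA_sqr mmNr mulmx1.
by rewrite /omA trM gA_sym trmxK e.
Qed.

Let omA_closed i j k :
  D i (omA j k) + D j (omA k i) + D k (omA i j) = 0.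
Proof.
rewrite (skewE omA_skew i k) derN.
by apply: rep_eq0 (rep_ext_d2 i j k rep_om) _ => y Uy; exact: om_closed.
Qed.

Let JA_int k i j : \sum_l (JA l i * D l (JA k j) - JA l j * D l (JA k i)
    + JA k l * D j (JA l i) - JA k l * D i (JA l j)) = 0.
Proof.
apply: (@rep_eq0 (nijenhuis J k i j)) => [|y Uy]; last exact: J_int.
apply: rep_sum => l.
by apply: repB; [apply: repD; [apply: repB|]|]; apply: repM;
  try apply: rep_partial; exact: rep_J.
Qed.

Let rep_metric s : rep (fun x => metric_tensor g x s) (gA (s b0) (s b1)).
Proof.
have -> : b0 = ord0 by apply: val_inj.
have -> : b1 = ord_max by apply: val_inj.
exact: rep_g.
Qed.

Let VA_killing i j : \sum_k VA k * D k (gA i j)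
    + \sum_k D i (VA k) * gA k j + \sum_k D j (VA k) * gA i k = 0.
Proof.
by apply: rep_eq0 (rep_lie2 i j rep_metric) _ => y Uy; exact: V_killing.
Qed.

Let VA_sympl i j : \sum_k VA k * D k (omA i j)
    + \sum_k D i (VA k) * omA k j + \sum_k D j (VA k) * omA i k = 0.
Proof.
by apply: rep_eq0 (rep_lie2 i j rep_om) _ => y Uy; exact: V_sympl.
Qed.

Let gA_flat :
  \sum_i \sum_j GA i j * ric D (christ D gA GA) i j = 0.
Proof.
apply: (@rep_eq0 (scalar_curvature g)) => [|y Uy]; last exact: g_flat.
apply: rep_sum => i; apply: rep_sum => j.
by apply: repM; [exact: rep_G | exact: rep_ricci].
Qed.

Definition kahlerA : kahler_data D :=
  @KahlerData _ D gA GA JA VA gA_sym GK JA_sqr JA_orth omA_closed JA_int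
    VA_killing VA_sympl gA_flat.

Local Notation X := kahlerA.

Lemma rep_flat s : rep (fun x => flat g V x s) (vflat X (s ord0)).
Proof. by apply: rep_sum => k; apply: repM; [exact: rep_V | exact: rep_g]. Qed.

Lemma rep_dz s : rep (fun x => killing_dz g J V x s) (zeta X (s ord0)).
Proof.
apply: repN; apply: rep_sum => k; apply: repM; first exact: rep_V.
have v0 : unlift ord0 b0 = None.
  by have -> : b0 = ord0 by [apply: val_inj]; rewrite unlift_none.
have v1 : unlift ord0 b1 = Some (@ord0 0).
  by have -> : b1 = lift ord0 (@ord0 0) by [apply: val_inj]; rewrite liftK.
have h := rep_om (fun i => if unlift ord0 i is Some i' then s i' else k).
by rewrite v0 v1 in h.
Qed.

Lemma rep_tau s : rep (fun x => ext_d (flat g V) x s) (tau X (s b0) (s b1)).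
Proof.
rewrite /tau mxE; apply: rep_ext_d1 => t; exact: rep_flat.
Qed.

Lemma rep_norm2 : rep (fun x => norm_vf g V x ^+ 2) (nrm2 X).
Proof.
move=> y Uy; rewrite sqr_sqrtr; last by rewrite ltW // g_pos // V_neq0.
have r : rep (fun y => \sum_j V y ord0 j * \sum_k V y ord0 k * g y k j) (nrm2 X).
  apply: rep_sum => j; apply: repM; first exact: rep_V.
  by apply: rep_sum => k; apply: repM; [exact: rep_V | exact: rep_g].
rewrite -r // exchange_big; apply: eq_bigr => j _ /=; rewrite mulr_sumr.
by apply: eq_bigr => k _; ring.
Qed.

Lemma exists_winv : exists w : A, w * nrm2 X = 1.
Proof.
apply: sfun_inv => y Uy; rewrite -(rep_norm2 Uy) sqr_sqrtr.
  by rewrite gt_eqF // g_pos // V_neq0.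
by rewrite ltW // g_pos // V_neq0.
Qed.

Lemma rep_laplacian z :
  (forall j, rep (partial j z) (zeta X j)) -> rep (laplacian g z) (lap X).
Proof.
move=> hz; rewrite -lap_hess; apply: rep_sum => i; apply: rep_sum => j.
apply: repM; first exact: rep_G.
apply: repB; first exact: rep_partial (hz j).
by apply: rep_sum => k; apply: repM; [exact: rep_christ | exact: hz].
Qed.

(** The Hodge star and the alternating sums are translated at one point: there
    the components are real numbers, and evaluation is a ring morphism. *)
Section AtPoint.
Variables (y : 'rV[R]_4) (Uy : inU y).
Let OmR : 'M[R]_4 := map_mx (ev Uy) omA.

Lemma om_at s : kahler_form g J y s = OmR (s b0) (s b1).
Proof. by rewrite (rep_om s Uy) [RHS]mxE. Qed.

Lemma OmR_skew : OmR^T = - OmR.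
Proof. by rewrite /OmR -map_mxN -omA_skew map_trmx. Qed.

Lemma vol_at s : dVol4 g J y s = pf OmR (s o0) (s o1) (s o2) (s o3).
Proof.
rewrite /dVol4 /scale_form (ct_wedge22 s OmR_skew OmR_skew om_at om_at).
by rewrite wedge22xx; field.
Qed.

Lemma invg_sym : (invmx (g y))^T = invmx (g y).
Proof. by rewrite -(ev_G Uy) map_trmx (imet_sym X). Qed.

Lemma ev_pf (B : 'M[A]_4) i j k l :
  pf (map_mx (ev Uy) B) i j k l = (pf B i j k l) y.
Proof. exact: map_pf. Qed.

Lemma ev_wedge22 (B C : 'M[A]_4) i j k l :
  wedge22 (map_mx (ev Uy) B) (map_mx (ev Uy) C) i j k l
  = (wedge22 B C i j k l) y.
Proof. exact: map_wedge22. Qed.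

Lemma lap_at : killing_laplacian g J V y = (lap X) y.
Proof.
pose T : 'M[R]_4 := map_mx (ev Uy) (tau X).
have sT : T^T = - T by rewrite /T -map_mxN -tau_skew map_trmx.
have tauE s : ext_d (flat g V) y s = T (s b0) (s b1).
  by rewrite (rep_tau s Uy) [RHS]mxE.
rewrite /killing_laplacian.
rewrite (ct_hodge40 _ sT OmR_skew (pf_alt OmR_skew) vol_at
  (fun s => ct_wedge22 s sT OmR_skew tauE om_at) invg_sym).
rewrite -(wedge_raise X) -[RHS]/(ev Uy _) rmorphM /=.
rewrite -(ev_G Uy) -!map_mxM ev_wedge22 ev_pf //.
Qed.

End AtPoint.

Lemma rep_killing_laplacian : rep (killing_laplacian g J V) (lap X).
Proof. by move=> y Uy; exact: lap_at. Qed.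

Lemma rep_wedge11 (a b : ctensor R 1) (e f : 'I_4 -> A) s :
  (forall s, rep (fun x => a x s) (e (s ord0))) ->
  (forall s, rep (fun x => b x s) (f (s ord0))) ->
  rep (fun x => wedge a b x s) (wedge11 e f (s b0) (s b1)).
Proof.
move=> ha hb y Uy; rewrite -[RHS]/(ev Uy _) -map_wedge11.
by apply: ct_wedge11 => t; [exact: ha | exact: hb].
Qed.

Lemma rep_wedge12 (a : ctensor R 1) (b : ctensor R 2) (e : 'I_4 -> A)
    (B : 'M[A]_4) s : B^T = - B ->
  (forall s, rep (fun x => a x s) (e (s ord0))) ->
  (forall s, rep (fun x => b x s) (B (s b0) (s b1))) ->
  rep (fun x => wedge a b x s) (wedge12 e B (s c0) (s c1) (s c2)).
Proof.
move=> sB ha hb y Uy; rewrite -[RHS]/(ev Uy _) -map_wedge12.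
apply: ct_wedge12 => [|t|t]; first by rewrite map_trmx sB map_mxN.
  exact: ha.
by rewrite mxE; exact: hb.
Qed.

Lemma rep_hodge2 (b : ctensor R 2) (B : 'M[A]_4) s :
  (forall s, rep (fun x => b x s) (B (s b0) (s b1))) ->
  rep (fun x => hodge g (k := 2) (l := 2) (dVol4 g J) b x s)
    (half D * \sum_i \sum_j
       (GA *m B *m GA) i j * pf (fund X) i j (s b0) (s b1)).
Proof.
move=> hb y Uy.
have hB t : b y t = map_mx (ev Uy) B (t b0) (t b1) by rewrite mxE; exact: hb.
rewrite (ct_hodge22 s (vol_at Uy) hB (invg_sym Uy)) -(ev_G Uy) -!map_mxM.
rewrite -[RHS]/(ev Uy _) [RHS]rmorphM; congr (_ * _).
  exact: (rep_cst (2^-1)).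
rewrite [RHS]rmorph_sum; apply: eq_bigr => i _.
rewrite [RHS]rmorph_sum; apply: eq_bigr => j _.
by rewrite [RHS]rmorphM [X in X * _]mxE -map_pf.
Qed.

Lemma rep_ext_d0 f F s : rep f F ->
  rep (fun x => ext_d (form0 f) x s) (D (s ord0) F).
Proof.
move=> h y Uy; rewrite /ext_d big_ord1 expr0 mul1r; exact: (rep_partial _ h).
Qed.

Lemma rep_J_form1 (a : ctensor R 1) (e : 'I_4 -> A) s :
  (forall s, rep (fun x => a x s) (e (s ord0))) ->
  rep (fun x => J_form1 J a x s) (\sum_k e k * JA k (s ord0)).
Proof.
move=> ha; apply: rep_sum => k; apply: repM; last exact: rep_J.
exact: (ha (fun _ => k)).
Qed.

Lemma rep_lie3 (Y : vector_field R) (YA : 'I_4 -> A) (T : ctensor R 3)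
    (t : 'I_4 -> 'I_4 -> 'I_4 -> A) s :
  (forall i, rep (fun x => Y x ord0 i) (YA i)) ->
  (forall s, rep (fun x => T x s) (t (s c0) (s c1) (s c2))) ->
  rep (fun x => lie Y T x s)
    (\sum_j YA j * D j (t (s c0) (s c1) (s c2))
     + (\sum_j D (s c0) (YA j) * t j (s c1) (s c2)
        + \sum_j D (s c1) (YA j) * t (s c0) j (s c2)
        + \sum_j D (s c2) (YA j) * t (s c0) (s c1) j)).
Proof.
move=> hY hT; apply: repD.
  apply: rep_sum => j; apply: repM; first exact: hY.
  exact: rep_partial (hT s).
move=> y Uy; rewrite sum3.
have r (i : 'I_3) j : rep (fun x => partial (s i) (fun z => Y z ord0 j) x
    * T x (fun k => if k == i then j else s k))
    (D (s i) (YA j) * t (if c0 == i then j else s c0)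
       (if c1 == i then j else s c1) (if c2 == i then j else s c2)).
  apply: repM; first exact: rep_partial (hY j).
  exact: (hT (fun k => if k == i then j else s k)).
exact: (repD (repD (rep_sum (r c0)) (rep_sum (r c1))) (rep_sum (r c2)) Uy).
Qed.

Section Primitive.
Variables (w : A) (zetaf : ctensor R 1) (uf : 'rV[R]_4 -> R).
Hypothesis w_inv : w * nrm2 X = 1.
Hypothesis rep_zeta : forall s, rep (fun x => zetaf x s) (zeta X (s ord0)).
Hypothesis rep_uf : rep uf (lap X).

Let rep_w : rep (fun x => (norm_vf g V x ^+ 2)^-1) w.
Proof.
move=> y Uy; have e : w y * nrm2 X y = 1 by rewrite -evalM // w_inv eval1.
rewrite -rep_norm2 // in e.
have n0 : norm_vf g V y ^+ 2 != 0.
  by apply/eqP => n0; move/eqP: e; rewrite n0 mulr0 eq_sym oner_eq0.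
by apply: (mulIf n0); rewrite e mulVf.
Qed.

Let rep_F : rep (fun x => (uf x / norm_vf g V x) ^+ 2) (ratio2 X w).
Proof.
move=> y Uy; rewrite expr_div_n expr2.
exact: (repM (repM rep_uf rep_uf) rep_w Uy).
Qed.

Let rep_d_dz i : rep (fun x => d_dz g V zetaf x ord0 i) (w * gradz X i).
Proof.
have h : rep (fun x => \sum_j ginv g x i j * zetaf x (fun _ => j)) (gradz X i).
  apply: rep_sum => j; apply: repM; first exact: rep_G.
  exact: (rep_zeta (fun _ => j)).
by move=> y Uy; rewrite !mxE; exact: (repM rep_w h Uy).
Qed.

Let vol2 : 'M[A]_4 := fund X - w *: wedge11 (zeta X) (vflat X).

Let vol2_skew : vol2^T = - vol2.
Proof.
rewrite /vol2 trD trN linearZ /= fund_skew.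
have -> : (wedge11 (zeta X) (vflat X))^T = - wedge11 (zeta X) (vflat X).
  by apply/matrixP => i j; rewrite trE mxN !wedge11E; ring.
by rewrite scalerN opprD.
Qed.

Let rep_dVol2 s : rep (fun x => dVol2 g J V zetaf x s) (vol2 (s b0) (s b1)).
Proof.
rewrite mxD mxN mxZ; apply: repB; first exact: rep_om.
by apply: repM rep_w _; apply: rep_wedge11 => t; [exact: rep_zeta|exact: rep_flat].
Qed.

Lemma rep_primitive s :
  rep (fun x => primitive_form g J V zetaf uf x s)
    (wedge12 (vflat X) (prim2 X w) (s c0) (s c1) (s c2)).
Proof.
rewrite -(primitiveE w_inv); apply: repB.
  apply: (rep_lie3 (t := gam X w) s rep_d_dz) => t; apply: repM; first exact: rep_F.
  exact: (rep_wedge12 t vol2_skew rep_flat rep_dVol2).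
apply: rep_wedge12 => [|r|r].
- rewrite linearZ /= -scalerN; congr (_ *: _).
  by apply/matrixP => i j; rewrite trE mxN !wedge11E; ring.
- by apply: rep_J_form1 => t; exact: rep_ext_d0.
rewrite mxZ -(hodge_vol2 w_inv); exact: rep_hodge2 rep_dVol2.
Qed.

Lemma rep_ricci_norm2 : rep (ricci_norm2 g) (ric_norm X).
Proof.
set S := ric D (christ D gA GA).
have -> : ric_norm X = \sum_i \sum_j \sum_k \sum_l
    GA i k * GA j l * S i j * S k l.
  have sS p q : S p q = S q p by rewrite -(trE S) (ric_sym X).
  rewrite /ric_norm mmA; apply: eq_bigr => i _; rewrite mulE.
  apply: eq_bigr => j _; rewrite (raise2E (imet_sym X)) mulr_suml.
  apply: eq_bigr => k _; rewrite mulr_suml; apply: eq_bigr => l _.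
  by rewrite [X in _ * X]sS; ring.
do 4!(apply: rep_sum => ?).
apply: repM; [apply: repM; [apply: repM|]|];
  by [exact: rep_G | exact: rep_ricci].
Qed.

Lemma local_identity x s : inU x ->
  scale_form (fun y => 2 * ricci_norm2 g y) (dVol4 g J) x s
  = ext_d (primitive_form g J V zetaf uf) x s.
Proof.
move=> Ux; rewrite (rep_ext_d3 (q := wedge12 (vflat X) (prim2 X w)) s rep_primitive Ux).
rewrite (der_primitive_all w_inv) evalM // evalD // -rep_ricci_norm2 //.
rewrite -ev_pf /scale_form (vol_at Ux); congr (_ * _); ring.
Qed.

End Primitive.

End WithInverse.

(** The two 1-forms of the theorem have the same components [zeta], and the two
    functions are both equal to [lap], so that the translation is the same. *)
Theorem local_identities x s : inU x ->
  scale_form (fun y => 2 * ricci_norm2 g y) (dVol4 g J) x s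
    = ext_d (primitive_form g J V (killing_dz g J V) (killing_laplacian g J V))
        x s
  /\ forall z,
    (forall y, inU y -> forall t,
       ext_d (form0 z) y t = killing_dz g J V y t) ->
    scale_form (fun y => 2 * ricci_norm2 g y) (dVol4 g J) x s
    = ext_d (primitive_form g J V (ext_d (form0 z)) (laplacian g z)) x s.
Proof.
move=> Ux; have [GA GK] := exists_inverse; have [w w_inv] := exists_winv GK.
split=> [|z dz].
  exact: (local_identity w_inv (rep_dz GK) (rep_killing_laplacian GK)).
have rep_ddz t : rep (fun x => ext_d (form0 z) x t) (zeta (kahlerA GK) (t ord0)).
  by move=> y Uy; rewrite dz //; exact: rep_dz.
apply: (local_identity w_inv rep_ddz) => //; apply: rep_laplacian => j y Uy.
by rewrite -(rep_ddz (fun _ => j)) // /ext_d big_ord1 expr0 mul1r.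
Qed.

End Local.

(** * The theorem on the manifold *)

Lemma smooth_onW (R : realType) (U W : set 'rV[R]_4) f :
  U `<=` W -> smooth_on W f -> smooth_on U f.
Proof. by move=> UW sf l x /UW; exact: sf. Qed.

Lemma open_neq0 (R : realType) (W : set 'rV[R]_4) (V : vector_field R) :
  open W -> (forall i, smooth_on W (fun x => V x ord0 i)) ->
  open (W `&` [set x | V x != 0]).
Proof.
move=> oW sV.
have -> : W `&` [set x | V x != 0]
    = \bigcup_(i in setT) (W `&` [set x | V x ord0 i != 0]).
  apply/seteqP; split=> [x [Wx /rV0Pn[i Vi]]|x [i _ [Wx Vi]]].
    by exists i.
  by split=> //; apply/rV0Pn; exists i.
apply: bigcup_open => i _.
have -> : W `&` [set x | V x ord0 i != 0]
    = W `&` (fun x => V x ord0 i) @^-1` [set t | t != 0] by [].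
rewrite openE => x [Wx Vx].
have cV : {for x, continuous (fun x => V x ord0 i)}.
  exact: differentiable_continuous (sV i [::] x Wx).
rewrite /interior; apply: filterI; first exact: open_nbhs_nbhs.
apply: cV; apply: open_nbhs_nbhs; split=> //; exact: open_neq.
Qed.

Theorem mainTheorem10 (R : realType) (M : manifold4 R)
    (J g : chart M -> matrix_field R) (V : chart M -> vector_field R)
    (hkahler : is_kahler J g) (hflat : scalar_flat g)
    (hV : is_vector_field V) (hkilling : is_killing g V)
    (hsympl : is_symplectomorphic J g V)
    (hcircle : generates_circle_action V) (a : chart M) :
  (forall x, img a x -> V a x != 0 -> forall s,
     scale_form (fun y => 2 * ricci_norm2 (g a) y) (dVol4 (g a) (J a)) x s
     = ext_d (primitive_form (g a) (J a) (V a) (killing_dz (g a) (J a) (V a))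
         (killing_laplacian (g a) (J a) (V a))) x s)
  /\
  (forall (W : set 'rV[R]_4) (z : 'rV[R]_4 -> R),
     open W -> W `<=` img a -> smooth_on W z ->
     (forall x, W x -> forall s,
        ext_d (form0 z) x s = killing_dz (g a) (J a) (V a) x s) ->
     forall x, W x -> V a x != 0 -> forall s,
     scale_form (fun y => 2 * ricci_norm2 (g a) y) (dVol4 (g a) (J a)) x s
     = ext_d (primitive_form (g a) (J a) (V a) (ext_d (form0 z))
         (laplacian (g a) z)) x s).
Proof.
case: hkahler => [[sJ _ J2 NJ] [sg _ g_sym g_pos] J_orth om_cl].
case: hV => sV _.
pose identity zetaf uf x s :=
  scale_form (fun y => 2 * ricci_norm2 (g a) y) (dVol4 (g a) (J a)) x s
  = ext_d (primitive_form (g a) (J a) (V a) zetaf uf) x s.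
have loc W x s : open W -> W `<=` img a -> W x -> V a x != 0 ->
    identity (killing_dz (g a) (J a) (V a)) (killing_laplacian (g a) (J a) (V a))
      x s
    /\ forall z, (forall y, W y -> forall t,
        ext_d (form0 z) y t = killing_dz (g a) (J a) (V a) y t) ->
      identity (ext_d (form0 z)) (laplacian (g a) z) x s.
  move=> oW Wa Wx Vx.
  have oU := open_neq0 oW (fun i => smooth_onW Wa (sV a i)).
  pose U := Domain oU (conj Wx Vx).
  have Ua : carrier U `<=` img a by move=> y [/Wa].
  have sgU i j := smooth_onW Ua (sg a i j).
  have sJU i j := smooth_onW Ua (sJ a i j).
  have sVU i := smooth_onW Ua (sV a i).
  suff [id1 id2] : identity (killing_dz (g a) (J a) (V a))
        (killing_laplacian (g a) (J a) (V a)) x s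
      /\ forall z, (forall y, carrier U y -> forall t,
          ext_d (form0 z) y t = killing_dz (g a) (J a) (V a) y t) ->
        identity (ext_d (form0 z)) (laplacian (g a) z) x s.
    by split=> [//|z dz]; apply: id2 => y [/dz].
  apply: (local_identities sgU sJU sVU).
  - by move=> y /Ua; exact: g_sym.
  - by move=> y /Ua; exact: g_pos.
  - by move=> y /Ua; exact: J2.
  - by move=> y /Ua; exact: J_orth.
  - by move=> y /Ua; exact: NJ.
  - by move=> y /Ua; exact: om_cl.
  - by move=> y /Ua; exact: hkilling.
  - by move=> y /Ua; exact: hsympl.
  - by move=> y /Ua; exact: hflat.
  - by move=> y [].
  - by split.
split=> [x ax Vx s|W z oW Wa _ dz x Wx Vx s].
  exact: (loc _ x s (@img_open R M a) (fun _ => id) ax Vx).1.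
exact: (loc _ x s oW Wa Wx Vx).2 z dz.
Qed.
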